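(* Let $\mathcal{N},\mathcal{D},\beta\in\{0,1,2,\dots\}$ be such that $\mathcal{N}+\mathcal{D}+\beta\ge2$. Then there exist a connected compact finite metric graph $\mathcal{G}$ and a subset $D$ of its pendant vertices such that $|D|=\mathcal{D}$, $\mathcal{G}$ has exactly $\mathcal{N}$ pendant vertices not in $D$, $\mathcal{G}$ has first Betti number $\beta$, and the graph Laplacian $L(\mathcal{G},D)$ has an infinite sequence of (distinct) sharp eigenvalues.
   Context: A compact finite metric graph $\mathcal{G}$ is the quotient of a disjoint union of finitely many compact intervals of positive length (edges) $e_i=[x_{2i-1},x_{2i}]$ by an equivalence relation on the set of endpoints; the equivalence classes are the vertices. Loops and multiple edges are allowed. The degree of a vertex is the number of interval endpoints in its class; a pendant vertex is a vertex of degree one. $\mathcal{L}$ denotes the total length (sum of the edge lengths) and $\beta=|E|-|V|+1$ the first Betti number. Given a subset $D$ of the pendant vertices (the Dirichlet vertices; the other pendant vertices are called Neumann), $L(\mathcal{G},D)$ acts as $-\frac{d^2}{dx^2}$ on each edge, on functions $f\in\bigoplus_i H^2[x_{2i-1},x_{2i}]$ that are continuous on $\mathcal{G}$, satisfy $f(v)=0$ for all $v\in D$, and satisfy the Kirchhoff condition $\sum_{x_j\in v}\partial f(x_j)=0$ at every vertex $v\notin D$, where $\partial f(x_{2i-1})=f'(x_{2i-1})$ and $\partial f(x_{2i})=-f'(x_{2i})$. It is self-adjoint in $L_2(\mathcal{G})$ with discrete spectrum $0\le\lambda_1\le\lambda_2\le\dots$ (counted with multiplicity). Define for $n\in\mathbb{N}=\{1,2,\dots\}$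 $$M_n=\frac{\pi^2}{\mathcal{L}^2}\Big(n-2+\mathcal{D}+\frac{\mathcal{N}+\beta}{2}+\beta\Big)^2,$$ and, for $n\ge2$, or for $n\geq 1$ if $\mathcal{D}\ne0$, $$m_n=\begin{cases}\frac{\pi^2}{\mathcal{L}^2}\frac{n^2}{4}& n<\mathcal{N}+\beta,\\ \frac{\pi^2}{\mathcal{L}^2}\big(n-\frac{\mathcal{N}+\beta}{2}\big)^2& n\ge\mathcal{N}+\beta;\end{cases}$$ if $\mathcal{D}=0$ put $m_1=0$ (in that case $\lambda_1=0$). $\lambda_n$ is lower sharp if $\lambda_n=m_n$ and upper sharp if $\lambda_n=M_n$. An eigenvalue $\lambda=\lambda_n=\dots=\lambda_{n+m-1}$ of multiplicity $m\ge1$ ($n$ the smallest index) is sharp if $\lambda_n$ is upper sharp and $\lambda_{n+m-1}$ is lower sharp. *)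

(* Defs.v *)
From HB Require Import structures.
From mathcomp Require Import all_boot all_order all_algebra.
From mathcomp Require Import all_classical all_reals all_analysis.

Set Implicit Arguments.
Unset Strict Implicit.
Unset Printing Implicit Defensive.

Import Order.TTheory GRing.Theory Num.Theory.
Import numFieldNormedType.Exports.

Local Open Scope ring_scope.

(* The edge [e] is the interval [position (e, false), position (e, true)];  *)
(* the endpoints are the pairs [(e, b)], where [b] tells the right   *)
(* endpoint from the left one.                                                *)
Record metric_graph (R : realType) := MetricGraph {
  edge : finType;
  position : edge * bool -> R;
  position_lt : forall e, position (e, false) < position (e, true);
  glued : rel (edge * bool);
  glued_equiv : equivalence_rel glued
}.

Section Combinatorics.
Variables (R : realType) (G : metric_graph R).

Definition endpoint : finType := (edge G * bool)%type.

Definition vertices : {set {set endpoint}} :=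
  equivalence_partition (@glued R G) [set: endpoint]%SET.

Definition degree (v : {set endpoint}) : nat := #|v|.

Definition pendants : {set {set endpoint}} :=
  [set v in vertices | degree v == 1%N]%SET.

Definition total_length : R :=
  \sum_(e : edge G) (position (e, true) - position (e, false)).

(* [int]-valued, to avoid truncated subtraction. *)
Definition betti : int := #|edge G|%:Z - #|vertices|%:Z + 1.

(* Two endpoints are adjacent when they are glued or bound the same edge. *)
Definition adjacent : rel endpoint :=
  [rel p q : endpoint | glued p q || (p.1 == q.1)].

Definition connected_graph : Prop :=
  (0 < #|edge G|)%N /\ forall p q : endpoint, connect adjacent p q.

End Combinatorics.

Section Laplacian.
Variables (R : realType) (G : metric_graph R).

Local Notation mu := (@lebesgue_measure R).

Definition L2_on (a b : R) (g : R -> R) : Prop :=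
  (g \_ `[a, b]%classic) \in Lfun mu 2%:E.

(* [f] is in H^1[a, b] with weak derivative [g]: it is the absolutely         *)
(* continuous representative given by the primitive of [g].                   *)
Definition weak_derivative (a b : R) (f g : R -> R) : Prop :=
  L2_on a b g /\
  forall x, x \in `[a, b] -> f x = f a + \int[mu]_(t in `[a, x]%classic) g t.

(* [f] is in H^2[a, b], with [f'] the continuous representative of its        *)
(* derivative and [f''] a representative of its second derivative.            *)
Definition H2_on (a b : R) (f f' f'' : R -> R) : Prop :=
  weak_derivative a b f f' /\ weak_derivative a b f' f''.

(* A function on the graph is a family of functions indexed by the edges; the *)
(* values of [f e] off the interval of [e] are irrelevant.                    *)
Implicit Types f : edge G -> R -> R.

Definition at_endpoint f (p : endpoint G) : R := f p.1 (position p).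

(* [f'] at a left endpoint, [- f'] at a right endpoint *)
Definition inward_derivative (f' : edge G -> R -> R) (p : endpoint G) : R :=
  (-1) ^+ p.2 * at_endpoint f' p.

Definition eq_on_graph (f g : edge G -> R -> R) : Prop :=
  forall e x, x \in `[position (e, false), position (e, true)] -> f e x = g e x.

Definition in_domain (D : {set {set endpoint G}})
    (f f' f'' : edge G -> R -> R) : Prop :=
  [/\ forall e, H2_on (position (e, false)) (position (e, true))
                      (f e) (f' e) (f'' e),
      forall p q : endpoint G, glued p q -> at_endpoint f p = at_endpoint f q,
      forall v p, v \in D -> p \in v -> at_endpoint f p = 0
    & forall v, v \in vertices G -> v \notin D ->
        \sum_(p in v) inward_derivative f' p = 0].

(* The kernel of L(G, D) - lambda, which contains 0. *)
Definition in_eigenspace (D : {set {set endpoint G}}) (lambda : R) f : Prop :=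
  exists f' f'' : edge G -> R -> R, in_domain D f f' f'' /\
    forall e, {ae mu, forall x,
      x \in `[position (e, false), position (e, true)] ->
      - f'' e x = lambda * f e x}.

(* The dimension of the eigenspace, functions being identified when they      *)
(* agree on the graph: uniqueness of [c] makes [phi] a basis.                 *)
Definition has_multiplicity (D : {set {set endpoint G}}) (lambda : R)
    (m : nat) : Prop :=
  exists phi : 'I_m -> edge G -> R -> R,
    (forall i, in_eigenspace D lambda (phi i)) /\
    forall f, in_eigenspace D lambda f ->
      exists! c : 'rV[R]_m,
        eq_on_graph f (fun e x => \sum_(i < m) c 0 i * phi i e x).

(* [lambda 1 <= lambda 2 <= ...] lists the eigenvalues of L(G, D), each as    *)
(* many times as its multiplicity (0 for a real which is not an eigenvalue);  *)
(* [lambda 0] is not used.                                                    *)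
Definition eigenvalue_listing (D : {set {set endpoint G}})
    (lambda : nat -> R) : Prop :=
  (forall n, (0 < n)%N -> lambda n <= lambda n.+1) /\
  forall x : R, exists m,
    has_multiplicity D x m /\
    ([set n : nat | (0 < n)%N /\ lambda n = x]%classic #= `I_m)%card.

End Laplacian.

Section Sharpness.
Variables (R : realType) (G : metric_graph R) (D : {set {set endpoint G}}).

Local Notation dirichlet := (#|D|%:R : R).
Local Notation neumann := (#|pendants G :\: D|%:R : R).
Local Notation beta := ((betti G)%:~R : R).

Definition upper_bound (n : nat) : R :=
  pi ^+ 2 / total_length G ^+ 2 *
  (n%:R - 2 + dirichlet + (neumann + beta) / 2 + beta) ^+ 2.

Definition lower_bound (n : nat) : R :=
  if (#|D| == 0%N) && (n == 1%N) then 0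
  else if n%:R < neumann + beta then
    pi ^+ 2 / total_length G ^+ 2 * (n%:R ^+ 2 / 4)
  else
    pi ^+ 2 / total_length G ^+ 2 * (n%:R - (neumann + beta) / 2) ^+ 2.

Definition lower_sharp (lambda : nat -> R) (n : nat) : Prop :=
  lambda n = lower_bound n.

Definition upper_sharp (lambda : nat -> R) (n : nat) : Prop :=
  lambda n = upper_bound n.

(* [n] is the smallest index of the eigenvalue [x] and [m] its multiplicity. *)
Definition sharp (lambda : nat -> R) (x : R) : Prop :=
  exists n m : nat,
    [/\ (0 < n)%N /\ (0 < m)%N,
        forall i, (0 < i)%N -> (lambda i = x <-> (n <= i < n + m)%N),
        upper_sharp lambda n
      & lower_sharp lambda (n + m - 1)%N].

End Sharpness.

(* Main.v *)
Require Import Defs.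
From mathcomp Require Import all_boot all_order all_algebra.
From mathcomp Require Import all_classical all_reals all_analysis.
From mathcomp Require Import measurable_realfun ring lra zify.

Set Implicit Arguments.
Unset Strict Implicit.
Unset Printing Implicit Defensive.

Import Order.TTheory GRing.Theory Num.Theory.
Import numFieldNormedType.Exports.

Local Open Scope classical_set_scope.
Local Open Scope ring_scope.

(* The graph is a star with [N0] Neumann legs of length 1, [D0] Dirichlet     *)
(* legs of length 2 and [beta0] lollipops: a leg of length 1 with a loop of   *)
(* length 4 at its end.  Solving [- f'' = lam f] from the outer end of each   *)
(* leg (from the middle of the loop for a lollipop) leaves one amplitude per  *)
(* leg, plus the functions on a loop which are odd about its middle and       *)
(* vanish on the rest of the graph.  Only the conditions at the center remain:*)
(* a system [alpha h * u h = z], [sum_h gam h * u h = 0].  When               *)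
(* [k = pi / 2 + pi j] all the [alpha h] vanish and all the odd functions are *)
(* admissible, so that the multiplicity of [k ^+ 2] is                        *)
(* [N0 + D0 + 2 beta0 - 1], which is exactly what makes the bounds [m_n] and  *)
(* [M_n] meet.  As the lengths are integers, for [k > 0] the multiplicity     *)
(* only depends on [y = sin k ^+ 2]; it is found from a polynomial of degree  *)
(* 2 in [y], and the spectrum is listed period by period.                     *)

(** Let [L = 2 D0 + N0 + 5 beta0] be the length of the lollipop star, and let [k ^+ 2] have first
    index [n] and multiplicity [m]. Away from the small indices, sharpness says that [k L / pi]
    equals both [n - 2 + D0 + N0 / 2 + 3 beta0 / 2] and [n + m - 1 - (N0 + beta0) / 2]. Hence [m]
    has to be [D0 + N0 + 2 beta0 - 1], and exactly the right number of eigenvalues has to lie below.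

    At [k = pi / 2 + pi j] the value at the center is forced to be 0, every leg has a free
    amplitude, and a single Kirchhoff condition remains at the center; with the [beta0] odd
    functions on the loops this gives the required [m]. For the position, each interval
    [pi j < k <= pi (j + 1)] carries [L] eigenvalues, and exactly [beta0 + 1] eigenvalues, 0
    included, have [k < pi / 2]. So the index starts at [n = j L + beta0 + 2], and both bounds
    become [(pi / L) ^+ 2 * (j L + L / 2) ^+ 2].

    [in_eigenspaceP] turns an eigenspace into vertex conditions, [lstar_eigenspaceP] reduces these
    to a star system, and [star_solution_space] computes its dimension. The multiplicities so
    obtained are collected over one period in [period_block], listed in [star_spectrum_listing], and
    compared with the bounds in [star_spectrum_sharp]. *)

Section WeakDerivative.
Variable R : realType.
Local Notation mu := (@lebesgue_measure R).
Implicit Types (a b x : R) (f g h : R -> R).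

Lemma bounded_Lfun2 h a b (M : R) :
  measurable_fun `[a, b]%classic h ->
  (forall x, x \in `[a, b] -> `|h x| <= M) -> L2_on a b h.
Proof.
move=> mh hM; rewrite /L2_on.
have mab : measurable (`[a, b]%classic : set R) by [].
have mhr : measurable_fun setT (h \_ `[a, b]%classic).
  exact/(measurable_restrictT h mab).
rewrite inE; apply/andP; split; rewrite inE//= /finite_norm unlock /Lnorm.
apply: poweR_lty.
have -> : (fun x : R => (`|(h \_ `[a, b]%classic) x|%:E `^ 2)%E) =
    ((fun x => (`|h x| `^ 2)%:E) \_ `[a, b]%classic).
  apply/funext => x /=; rewrite !patchE; case: ifPn => //= _.
  by rewrite normr0 powR0.
rewrite -integral_mkcond.
apply: (@le_lt_trans _ _ (\int[mu]_(x in `[a, b]%classic) (M `^ 2)%:E)%E).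
  apply: ge0_le_integral => //.
  - apply/measurable_EFinP.
    apply: (@measurableT_comp _ _ _ _ _ _ (fun x : R => x `^ 2)) => //.
    exact: measurableT_comp.
  - move=> x xab; rewrite lee_fin ge0_ler_powR// ?nnegrE ?hM//.
    by rewrite (le_trans _ (hM x xab)).
rewrite integral_cst//= lebesgue_measure_itv/=.
by case: ifP => _; rewrite -?EFinD -?EFinM ?mule0 ltry.
Qed.

Lemma continuous_Lfun2 h a b : a <= b -> continuous h -> L2_on a b h.
Proof.
move=> ab ch; have ch' := @continuous_subspaceT _ _ `[a, b]%classic h ch.
have [c _ hc] := EVT_max ab ch'; have [d _ hd] := EVT_min ab ch'.
apply: (@bounded_Lfun2 _ _ _ (`|h c| + `|h d|)).
  by apply: measurable_funTS; exact: continuous_measurable_fun.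
move=> x xab; rewrite ler_norml; have := hc x xab; have := hd x xab.
have := ler_norm (h c); have := ler_norm (- h d); have := normr_ge0 (h c).
by rewrite normrN; have := normr_ge0 (h d); lra.
Qed.

Lemma L2_on_integrable a b g : L2_on a b g ->
  mu.-integrable `[a, b]%classic (EFin \o g).
Proof.
move=> g2.
have mab : measurable (`[a, b]%classic : set R) by [].
have i2 : L2_on a b (cst 1).
  by apply: (@bounded_Lfun2 _ _ _ 1) => // x _; rewrite normr1.
have := Lfun2_mul_Lfun1 g2 i2; move/Lfun1_integrable => h.
apply/integrable_mkcond => //; rewrite restrict_EFin.
apply: eq_integrable h => //= x _ /=.
by congr EFin; rewrite !patchE; case: ifP; rewrite ?mulr1 ?mulr0.
Qed.

Lemma weak_derivative_continuous a b f g : a < b ->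
  weak_derivative a b f g -> {within `[a, b]%classic, continuous f}.
Proof.
move=> ab [/L2_on_integrable gi fE].
have := parameterized_integral_continuous (ltW ab) gi => cF.
pose F := fun x => f a + parameterized_integral mu a x g.
have cF2 : {within `[a, b]%classic, continuous F}.
  by move=> x; apply: cvgD; [exact: cvg_cst|exact: cF].
apply: subspace_eq_continuous cF2 => x; rewrite inE/= => xab.
exact/esym/fE.
Qed.

(** A primitive does not see null sets, so [g] may be replaced by its continuous representative [h],
    to which the fundamental theorem of calculus applies. This makes an equation holding almost
    everywhere a classical one. *)
Lemma weak_derivative_is_derive a b f g h : a < b ->
  weak_derivative a b f g -> {within `[a, b]%classic, continuous h} ->
  {ae mu, forall x, x \in `[a, b] -> g x = h x} ->
  forall x, x \in `]a, b[ -> is_derive x 1 f (h x).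
Proof.
move=> ab [/L2_on_integrable gi fE] ch gh x xab.
have hi : mu.-integrable `[a, b]%classic (EFin \o h).
  by apply: continuous_compact_integrable => //; exact: segment_compact.
have [ax xb] : a < x /\ x < b by move: (xab); rewrite in_itv => /andP.
have cx := within_continuous_continuous ab ch xab.
have [dF F'] := continuous_FTC1_closed xb hi ax cx.
pose F := fun y : R => \int[mu]_(t in `[a, y]) h t.
have FD : is_derive x 1 (fun y => f a + F y) (h x).
  rewrite -[h x]add0r; apply: is_deriveD.
  by apply: DeriveDef; [exact: dF|rewrite -derive1E; exact: F'].
apply: near_eq_is_derive FD.
have : \forall y \near x, y \in `]a, b[ by apply: near_in_itvoo.
apply: filterS => y yab.
have yab' : y \in `[a, b] by exact: subset_itv_oo_cc yab.
rewrite (fE y)//; congr (_ + _); congr fine.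
have sub : (`[a, y] `<=` `[a, b])%classic.
  move=> z; rewrite /= !in_itv/= => /andP[-> zy]; apply: (le_trans zy).
  by move: yab; rewrite in_itv/= => /andP[_ /ltW].
apply: ae_eq_integral => //.
- by case/integrableP: hi => + _; apply: measurable_funS.
- by case/integrableP: gi => + _; apply: measurable_funS.
- have [N [mN N0 sN]] := gh; exists N; split => //.
  by move=> z /= Nz; apply: sN => /= Hz; apply: Nz => /sub /Hz ->.
Qed.

Lemma is_derive_weak_derivative a b f g h : a < b ->
  (forall x, is_derive x 1 g (h x)) -> continuous h ->
  {in `[a, b], f =1 g} -> weak_derivative a b f h.
Proof.
move=> ab gh ch fg; split; first exact: continuous_Lfun2 (ltW ab) ch.
move=> x xab; have [ax xb] : a <= x /\ x <= b.
  by move: (xab); rewrite in_itv => /andP.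
move: (ax); rewrite le_eqVlt => /predU1P[<-|ltax].
  by rewrite set_itv1 Rintegral_set1 addr0.
rewrite !fg//; last by rewrite in_itv/= lexx ltW.
have dg y : derivable g y 1 by case: (gh y).
have cg y : {for y, continuous g}.
  exact/differentiable_continuous/derivable1_diffP.
rewrite /Rintegral (@continuous_FTC2 _ _ g)//=; first ring.
- exact: continuous_subspaceT.
- split=> //; [apply: cvg_at_right_filter|apply: cvg_at_left_filter];
    exact: cg.
- by move=> y _; rewrite derive1E; have [_ ->] := gh y.
Qed.

Lemma is_derive0_cst a b (u : R -> R) :
  a < b -> {within `[a, b]%classic, continuous u} ->
  (forall x, x \in `]a, b[ -> is_derive x 1 u 0) ->
  {in `[a, b], forall x, u x = u a}.
Proof.
move=> ab cu du x; rewrite in_itv/= => /andP[ax xb].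
have [||c _] := @MVT_segment _ u (cst 0) a x ax.
- move=> y; rewrite in_itv/= => /andP[ay yx]; apply: du.
  by rewrite in_itv/= ay (lt_le_trans yx).
- apply: continuous_subspaceW cu => y; rewrite /= !in_itv/= => /andP[->] yx.
  exact: le_trans yx xb.
- by rewrite mul0r => /subr0_eq.
Qed.

End WeakDerivative.

(** * The equation [- f'' = lam f] on one edge *)

(** The normalized cosine and sine of the equation, abstracted so that all signs of [lam] are
    treated together. [fund_norm] says that their Wronskian is 1. *)
Record fundamental (R : realType) (lam : R) (C S : R -> R) : Prop :=
Fundamental {
  fund_dC : forall x : R, is_derive x 1 C (- lam * S x);
  fund_dS : forall x : R, is_derive x 1 S (C x);
  fund_C0 : C 0 = 1;
  fund_norm : forall x, C x ^+ 2 + lam * S x ^+ 2 = 1;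
  fund_even : forall x, C (- x) = C x;
  fund_odd : forall x, S (- x) = - S x
}.

Section EdgeEquation.
Variables (R : realType) (lam : R) (C S : R -> R).
Hypothesis CS : fundamental lam C S.
Local Notation mu := (@lebesgue_measure R).

Lemma fund_cC : continuous C.
Proof.
move=> x; apply/differentiable_continuous/derivable1_diffP.
by case: (fund_dC CS x).
Qed.

Lemma fund_cS : continuous S.
Proof.
move=> x; apply/differentiable_continuous/derivable1_diffP.
by case: (fund_dS CS x).
Qed.

Lemma fund_dcomb (p q x : R) :
  is_derive x 1 (fun x => p * C x + q * S x) (q * C x - lam * p * S x).
Proof.
have dC := fund_dC CS x; have dS := fund_dS CS x.
apply: is_derive_eq (is_deriveD (is_deriveZ p dC) (is_deriveZ q dS)) _.
rewrite /GRing.scale /=; ring.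
Qed.

(* The two first integrals [f C - f' S] and [lam f S + f' C] of the equation *)
(* are the coordinates of [f] in the basis [C], [S].                          *)
Lemma edge_equation_solution (a b : R) f f' f'' : a < b -> H2_on a b f f' f'' ->
  {ae mu, forall x, x \in `[a, b] -> - f'' x = lam * f x} ->
  exists p q, forall x, x \in `[a, b] ->
    f x = p * C x + q * S x /\ f' x = q * C x - lam * p * S x.
Proof.
move=> ab [wf wf'] fE.
have cf := weak_derivative_continuous ab wf.
have cf' := weak_derivative_continuous ab wf'.
have df := weak_derivative_is_derive ab wf cf' (aeW _ (fun x _ => erefl)).
have ch : {within `[a, b]%classic, continuous (fun x => - lam * f x)}.
  by move=> x; apply: cvgM; [exact: cvg_cst|exact: cf].
have df' x : x \in `]a, b[ -> is_derive x 1 f' (- lam * f x).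
  apply: (weak_derivative_is_derive ab wf' ch).
  have [N [mN N0 sN]] := fE; exists N; split => //.
  move=> z /= Nz; apply: sN => /= Hz; apply: Nz => /Hz.
  by rewrite mulNr => <-; rewrite opprK.
have cC : {within `[a, b]%classic, continuous C}.
  by apply: continuous_subspaceT; exact: fund_cC.
have cS : {within `[a, b]%classic, continuous S}.
  by apply: continuous_subspaceT; exact: fund_cS.
pose u x := f x * C x - f' x * S x.
pose w x := lam * (f x * S x) + f' x * C x.
have cu : {within `[a, b]%classic, continuous u}.
  move=> x; apply: cvgB; apply: cvgM;
    [exact: cf|exact: cC|exact: cf'|exact: cS].
have cw : {within `[a, b]%classic, continuous w}.
  move=> x; apply: cvgD; apply: cvgM.
  - exact: cvg_cst.
  - by apply: cvgM; [exact: cf|exact: cS].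
  - exact: cf'.
  - exact: cC.
have du x : x \in `]a, b[ -> is_derive x 1 u 0.
  move=> xab; have dfx := df x xab; have df'x := df' x xab.
  have dC := fund_dC CS x; have dS := fund_dS CS x.
  apply: is_derive_eq (is_deriveB (is_deriveM dfx dC) (is_deriveM df'x dS)) _.
  rewrite /GRing.scale /=; ring.
have dw x : x \in `]a, b[ -> is_derive x 1 w 0.
  move=> xab; have dfx := df x xab; have df'x := df' x xab.
  have dC := fund_dC CS x; have dS := fund_dS CS x.
  apply: is_derive_eq
    (is_deriveD (is_deriveZ lam (is_deriveM dfx dS)) (is_deriveM df'x dC)) _.
  rewrite /GRing.scale /=; ring.
have uE := is_derive0_cst ab cu du; have wE := is_derive0_cst ab cw dw.
exists (u a), (w a) => x xab; have N := fund_norm CS x.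
rewrite -(uE x xab) -(wE x xab) /u /w; split.
- by rewrite -[LHS]mulr1 -N; ring.
- by rewrite -[LHS]mulr1 -N; ring.
Qed.

Lemma edge_equation_H2 (a b p q : R) f : a < b ->
  {in `[a, b], forall x, f x = p * C x + q * S x} ->
  H2_on a b f (fun x => q * C x - lam * p * S x)
    (fun x => - lam * (p * C x + q * S x)).
Proof.
move=> ab fE; have cC := fund_cC; have cS := fund_cS.
have cc (c d : R) : continuous (fun x => c * C x + d * S x).
  move=> x; apply: cvgD; apply: cvgM;
    [exact: cvg_cst|exact: cC|exact: cvg_cst|exact: cS].
split.
- apply: (is_derive_weak_derivative ab (fund_dcomb p q) _ fE).
  move=> x; apply: cvgB; apply: cvgM;
    [exact: cvg_cst|exact: cC|exact: cvg_cst|exact: cS].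
- apply: (@is_derive_weak_derivative _ _ _ _
    (fun x => q * C x + - (lam * p) * S x) _ ab).
  + move=> x; apply: is_derive_eq (fund_dcomb q (- (lam * p)) x) _; ring.
  + by move=> x; apply: cvgM; [exact: cvg_cst|exact: cc].
  + by move=> x _; rewrite mulNr.
Qed.

Lemma fund_S0 : S 0 = 0.
Proof. have := fund_odd CS 0; rewrite oppr0; lra. Qed.

(** Value and derivative both vanish at the midpoint, and the Wronskian 1 makes this linear system
    in [p], [q] invertible. *)
Lemma fund_free (a b p q : R) : a < b ->
  {in `[a, b], forall x, p * C x + q * S x = 0} -> p = 0 /\ q = 0.
Proof.
move=> ab H0; pose c := (a + b) / 2.
have cab : c \in `]a, b[ by rewrite in_itv /c /=; lra.
have dc := fund_dcomb p q c.
have : is_derive c 1 (cst 0 : R -> R) (q * C c - lam * p * S c).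
  apply: near_eq_is_derive dc.
  have : \forall y \near c, y \in `]a, b[ by apply: near_in_itvoo.
  by apply: filterS => y /subset_itv_oo_cc; exact: H0.
move=> [_]; rewrite derive_cst => d0.
have v0 := H0 c (subset_itv_oo_cc cab); have N := fund_norm CS c.
split.
- transitivity ((p * C c + q * S c) * C c - (q * C c - lam * p * S c) * S c).
    by rewrite -[LHS]mulr1 -N; ring.
  by rewrite v0 -d0; ring.
- transitivity (lam * (p * C c + q * S c) * S c +
    (q * C c - lam * p * S c) * C c).
    by rewrite -[LHS]mulr1 -N; ring.
  by rewrite v0 -d0; ring.
Qed.

End EdgeEquation.

(** * Fundamental solutions for positive, zero and negative [lam] *)

Section FundamentalSolutions.
Variable R : realType.

Lemma is_derive_mull (f : R -> R) (c x df : R) :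
  is_derive (c * x) 1 f df -> is_derive x 1 (fun y => f (c * y)) (c * df).
Proof.
move=> dfx.
have d1 : is_derive x 1 (fun y : R => c * y) c.
  apply: is_derive_eq (is_deriveZ c (is_derive_id x 1)) _.
  by rewrite /GRing.scale /= mulr1.
apply: is_derive_eq (is_derive1_comp dfx d1) _.
by rewrite mulrC.
Qed.

Lemma fundamental_pos (k : R) : 0 < k ->
  fundamental (k ^+ 2) (fun x => cos (k * x)) (fun x => sin (k * x) / k).
Proof.
move=> k0; have kn : k != 0 by rewrite gt_eqF.
split=> [x|x||x|x|x].
- by apply: is_derive_eq (is_derive_mull (is_derive_cos _)) _; field.
- have := is_derive_mull (is_derive_sin (k * x)) => d.
  rewrite (_ : (fun y => sin (k * y) / k) = k^-1 \*: (fun y => sin (k * y))).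
    apply: is_derive_eq; rewrite /GRing.scale /=; by field.
  by apply/funext => y; rewrite mulrC.
- by rewrite mulr0 cos0.
- by rewrite -[RHS](cos2Dsin2 (k * x)); field.
- by rewrite mulrN cosN.
- by rewrite mulrN sinN mulNr.
Qed.

Lemma fundamental0 : fundamental (0 : R) (cst 1) id.
Proof.
split=> [x|x||x|x|x] //.
- by apply: is_derive_eq (is_derive_cst _ _ _) _; rewrite oppr0 mul0r.
- exact: is_derive_id.
- by rewrite mul0r addr0 expr1n.
Qed.

Lemma fundamental_neg (k : R) : 0 < k ->
  fundamental (- k ^+ 2)
    (fun x => (expR (k * x) + expR (- k * x)) / 2)
    (fun x => (expR (k * x) - expR (- k * x)) / (2 * k)).
Proof.
move=> k0; have kn : k != 0 by rewrite gt_eqF.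
have dp x := is_derive_mull (is_derive_expR (k * x)).
have dm x := is_derive_mull (is_derive_expR (- k * x)).
have pm x : expR (k * x) * expR (- k * x) = 1.
  by rewrite -expRD mulNr subrr expR0.
split=> [x|x||x|x|x].
- have d1 := dp x; have d2 := dm x.
  rewrite (_ : (fun x => (expR (k * x) + expR (- k * x)) / 2) =
    2^-1 \*: ((fun y => expR (k * y)) + (fun y => expR (- k * y)))).
    by apply: is_derive_eq; rewrite /GRing.scale /=; field.
  by apply/funext => y; rewrite /= mulrC.
- have d1 := dp x; have d2 := dm x.
  rewrite (_ : (fun x => (expR (k * x) - expR (- k * x)) / (2 * k)) =
    (2 * k)^-1 \*: ((fun y => expR (k * y)) - (fun y => expR (- k * y)))).
    by apply: is_derive_eq; rewrite /GRing.scale /=; field.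
  by apply/funext => y; rewrite /= mulrC.
- by rewrite !mulr0 expR0; field.
- have P := pm x; set E := expR _ in P *; set F := expR _ in P *.
  transitivity (E * F); last by [].
  by field.
- by rewrite !mulrN !mulNr opprK addrC.
- by rewrite -[RHS]mulNr opprB !mulrN !mulNr opprK.
Qed.

End FundamentalSolutions.

(** * Linear algebra of the conditions at the center *)

Section StarSystem.
Variables (F : fieldType) (H : finType) (alpha gam : H -> F).

(* [alpha h * u h] is the value at the center and [gam h * u h] the           *)
(* derivative at the center of a function on the leg [h].                     *)
Definition star_solution (u : H -> F) : Prop :=
  (exists z, forall h, alpha h * u h = z) /\ \sum_h gam h * u h = 0.

(* If some [alpha h] vanishes then the value at the center is 0 and only the  *)
(* legs with [alpha h = 0] contribute.                                        *)
Definition star_dim : nat :=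
  let z := #|[pred h | alpha h == 0]| in
  if z == 0%N then nat_of_bool (\sum_h gam h / alpha h == 0) else z.-1.

(** Without zeros of [alpha], [u] is a multiple of [1 / alpha], and the sum condition keeps all
    multiples or only 0. Otherwise [u] is supported on the zeros of [alpha], where the sum condition
    is a nonzero linear form because [gam] does not vanish there, and so cuts out a hyperplane. *)
Lemma star_solution_space : (0 < #|H|)%N ->
  (forall h, alpha h = 0 -> gam h != 0) ->
  exists X : 'M[F]_(star_dim, #|H|), row_free X /\
    forall u : 'rV_#|H|,
      (u <= X)%MS <-> star_solution (fun h => u 0 (enum_rank h)).
Proof.
move=> H0 ag; rewrite /star_dim; case: eqP => [z0|/eqP z0].
  have an0 h : alpha h != 0.
    by have /pred0P/(_ h)/= -> := introT eqP z0.
  pose w : 'rV[F]_#|H| := \row_i (alpha (enum_val i))^-1.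
  have wE (u : 'rV[F]_#|H|) : star_solution (fun h => u 0 (enum_rank h)) ->
      (exists z, u = z *: w) /\ \sum_h gam h * u 0 (enum_rank h) = 0.
    move=> [[z uz] us]; split=> //; exists z; apply/rowP => i; rewrite !mxE.
    by rewrite -(uz (enum_val i)) enum_valK mulrAC divff// mul1r.
  have wsum z : \sum_h gam h * (z *: w) 0 (enum_rank h) =
      z * \sum_h gam h / alpha h.
    rewrite mulr_sumr; apply: eq_bigr => h _; rewrite !mxE enum_rankK; ring.
  have [F0|F0] := eqVneq (\sum_h gam h / alpha h) 0.
    exists w; split.
      rewrite /row_free rank_rV; apply/eqP; congr nat_of_bool; apply/eqP => w0.
      have /card_gt0P[h _] := H0.
      have := congr1 (fun M : 'rV_#|H| => M 0 (enum_rank h)) w0.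
      by rewrite !mxE enum_rankK => /eqP; rewrite invr_eq0 (negbTE (an0 h)).
    move=> u; split=> [/sub_rVP[z ->]|/wE[[z ->] _]]; last exact: scalemx_sub.
    split; last by rewrite wsum F0 mulr0.
    by exists z => h; rewrite !mxE enum_rankK mulrCA mulrV ?unitfE// mulr1.
  exists (0 : 'M[F]_(0, #|H|)); split; first by rewrite /row_free mxrank0.
  move=> u; split=> [/submx0null->|/wE[[z ->]]].
    split; first by exists 0 => h; rewrite mxE mulr0.
    by apply: big1 => h _; rewrite mxE mulr0.
  rewrite wsum => /eqP; rewrite mulf_eq0 (negbTE F0) orbF => /eqP->.
  by rewrite scale0r sub0mx.
set A := [pred h | alpha h == 0] in z0 *.
(* [P] extends by 0 a vector indexed by the zeros of [alpha]; [P *m g] is the sum condition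
   restricted to such vectors. *)
pose P : 'M[F]_(#|A|, #|H|) := \matrix_(i, j) (enum_val j == enum_val i)%:R.
pose g : 'cV[F]_#|H| := \col_j gam (enum_val j).
have Pu (w : 'rV_#|A|) h : (w *m P) 0 (enum_rank h) =
    \sum_(i < #|A|) w 0 i * (h == enum_val i)%:R.
  by rewrite mxE; apply: eq_bigr => i _; rewrite mxE enum_rankK.
have PA (w : 'rV_#|A|) i : (w *m P) 0 (enum_rank (enum_val i)) = w 0 i.
  rewrite Pu (bigD1 i)//= eqxx mulr1 big1 ?addr0// => j ji.
  by rewrite (inj_eq enum_val_inj) eq_sym (negbTE ji) mulr0.
have PnA (w : 'rV_#|A|) h : h \notin A -> (w *m P) 0 (enum_rank h) = 0.
  move=> hA; rewrite Pu big1// => i _.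
  case: eqP => [hE|]; last by rewrite mulr0.
  by move: hA; rewrite hE enum_valP.
have Pfree : row_free P.
  apply: inj_row_free => w wP; apply/rowP => i.
  by rewrite -PA wP !mxE.
have gE (u : 'rV_#|H|) : (u *m g) 0 0 = \sum_h gam h * u 0 (enum_rank h).
  rewrite mxE (reindex (@enum_rank H)); last first.
    by apply: onW_bij; exact: enum_rank_bij.
  by apply: eq_bigr => h _; rewrite mxE enum_rankK mulrC.
have rK : \rank (kermx (P *m g)) = #|A|.-1.
  rewrite mxrank_ker -subn1; congr subn; apply/eqP; rewrite eqn_leq.
  rewrite rank_leq_col lt0n mxrank_eq0; apply/eqP => Pg0.
  have [h hA] : exists h, h \in A by apply/card_gt0P; rewrite lt0n.
  have := congr1 (fun M : 'cV_#|A| => M (enum_rank_in hA h) 0) Pg0.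
  rewrite !mxE (bigD1 (enum_rank h))//= !mxE enum_rankK enum_rankK_in// eqxx.
  rewrite mul1r big1 ?addr0 => [/eqP|j jh].
    by apply/negP/ag/eqP; move: hA; rewrite inE.
  rewrite !mxE enum_rankK_in//; case: eqP => [jE|]; last by rewrite mul0r.
  by move: jh; rewrite -jE enum_valK eqxx.
(* The number of rows is part of the type of [X], so the basis is built with the rank as row count
   and then transported along [rK]. *)
suff [X [Xf XP]] : exists X : 'M[F]_(\rank (kermx (P *m g)), #|H|),
    row_free X /\
    forall u : 'rV_#|H|,
      (u <= X)%MS <-> star_solution (fun h => u 0 (enum_rank h)).
  by move: X Xf XP; rewrite rK => X Xf XP; exists X.
exists (row_base (kermx (P *m g)) *m P); split.
  by rewrite /row_free mxrankMfree// eq_row_base.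
move=> u; split.
  move=> /submxP[c ->]; rewrite mulmxA; set w := c *m _.
  have wK : w *m (P *m g) = 0.
    by apply/sub_kermxP; rewrite (submx_trans (submxMl _ _))// eq_row_base.
  split; last by rewrite -gE -mulmxA wK mxE.
  exists 0 => h; have [/eqP->|/PnA ->] := boolP (h \in A); first exact: mul0r.
  exact: mulr0.
move=> [[z uz] us].
have [h0 h0A] : exists h, h \in A by apply/card_gt0P; rewrite lt0n.
have z_0 : z = 0 by rewrite -(uz h0) (eqP h0A) mul0r.
pose w : 'rV[F]_#|A| := \row_i u 0 (enum_rank (enum_val i)).
have uE : u = w *m P.
  apply/rowP => j; rewrite -[j]enum_valK.
  have [hA|hA] := boolP (enum_val j \in A).
    by rewrite -(enum_rankK_in hA hA) PA mxE.
  rewrite PnA//; apply/eqP; have /eqP := uz (enum_val j).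
  by rewrite z_0 mulf_eq0 (negbTE (_ : alpha _ != 0)).
rewrite uE; apply: submxMr; rewrite eq_row_base.
apply/sub_kermxP; rewrite mulmxA -uE.
by apply/matrixP => i j; rewrite !ord1 gE us mxE.
Qed.

End StarSystem.

(** * Eigenspaces and multiplicities on an arbitrary graph *)

Section Parametrization.
Variables (R : realType) (G : metric_graph R) (D : {set {set endpoint G}}).

(** An injective linear parametrization carries the rows of [X], a basis of the parameter space, to
    a basis of the eigenspace. *)
Lemma has_multiplicity_param (lam : R) (m n : nat) (X : 'M[R]_(m, n))
    (Phi : 'rV[R]_n -> edge G -> R -> R) :
  row_free X ->
  (forall a u v e x, Phi (a *: u + v) e x = a * Phi u e x + Phi v e x) ->
  (forall u v, eq_on_graph (Phi u) (Phi v) -> u = v) ->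
  (forall f, in_eigenspace D lam f <->
    exists u, (u <= X)%MS /\ eq_on_graph f (Phi u)) ->
  has_multiplicity D lam m.
Proof.
move=> Xf lin inj spaceP.
have Phi0 e x : Phi 0 e x = 0.
  have := lin (-1) 0 0 e x.
  by rewrite scaler0 addr0 mulN1r addNr.
have PhiE (c : 'rV_m) e x :
    \sum_(i < m) c 0 i * Phi (row i X) e x = Phi (c *m X) e x.
  rewrite mulmx_sum_row; elim: (index_enum _) => [|i s IH].
    by rewrite !big_nil Phi0.
  by rewrite !big_cons lin IH.
exists (fun i => Phi (row i X)); split.
  by move=> i; apply/spaceP; exists (row i X); split=> //; exact: row_sub.
move=> f /spaceP[u [/submxP[c uE] fE]]; exists c; split.
  by move=> e x ex; rewrite PhiE -uE fE.
move=> c' fc'; apply: (row_free_inj Xf); rewrite -uE; apply: inj => e x ex.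
by rewrite -fE// fc'// PhiE.
Qed.

End Parametrization.

Section Eigenspace.
Variables (R : realType) (G : metric_graph R) (D : {set {set endpoint G}}).
Variables (lam : R) (C S : R -> R).
Hypothesis CS : fundamental lam C S.

Definition comb (p q : edge G -> R) (e : edge G) (x : R) : R :=
  p e * C x + q e * S x.

Definition dcomb (p q : edge G -> R) (e : edge G) (x : R) : R :=
  q e * C x - lam * p e * S x.

(** The equation is solved edge by edge, with [dcomb] the derivative of [comb]; only the finitely
    many vertex conditions on the coefficients are left. *)
Lemma in_eigenspaceP f : in_eigenspace D lam f <->
  exists p q : edge G -> R, [/\ eq_on_graph f (comb p q),
    forall r s : endpoint G,
      glued r s -> at_endpoint (comb p q) r = at_endpoint (comb p q) s,
    forall v r, v \in D -> r \in v -> at_endpoint (comb p q) r = 0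
  & forall v, v \in vertices G -> v \notin D ->
      \sum_(r in v) inward_derivative (dcomb p q) r = 0].
Proof.
have inI (r : endpoint G) :
    position r \in `[position (r.1, false), position (r.1, true)].
  have := position_lt (r.1); case: r => e [] /= lt_e;
    by rewrite in_itv/= lexx ltW.
have val (f1 f2 : edge G -> R -> R) r :
    eq_on_graph f1 f2 -> at_endpoint f1 r = at_endpoint f2 r.
  by move=> f12; rewrite /at_endpoint f12.
split.
  move=> [f' [f'' [[H2 gl dir kir] fE]]].
  have /choice[p /choice[q pq]] (e : edge G) := edge_equation_solution CS
    (position_lt e) (H2 e) (fE e).
  have fpq : eq_on_graph f (comb p q) by move=> e x /pq[].
  have f'pq : eq_on_graph f' (dcomb p q) by move=> e x /pq[].
  exists p, q; split=> //.
  - by move=> r s rs; rewrite -!(val f _ _ fpq); exact: gl.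
  - by move=> v r vD rv; rewrite -(val f _ _ fpq); exact: (dir v).
  - move=> v vG vD; rewrite -[RHS](kir v vG vD).
    by apply: eq_bigr => r _; rewrite /inward_derivative -(val _ _ _ f'pq).
move=> [p [q [fpq gl dir kir]]].
exists (dcomb p q), (fun e x => - lam * comb p q e x); split.
  split.
  - by move=> e; apply: (edge_equation_H2 CS (position_lt e)) => x; exact: fpq.
  - by move=> r s rs; rewrite !(val _ _ _ fpq); exact: gl.
  - by move=> v r vD rv; rewrite (val _ _ _ fpq); exact: (dir v).
  - exact: kir.
move=> e; apply: aeW => x xe.
by rewrite (fpq e x xe) mulNr opprK.
Qed.

End Eigenspace.

(** * The lollipop star and its combinatorial invariants *)

Section LollipopStar.
Variables (R : realType) (ND NN NB : nat).

(* Dirichlet legs, Neumann legs and sticks of the lollipops. *)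
Definition leg : finType := ('I_ND + 'I_NN + 'I_NB)%type.

(* [inl h] is the leg [h], [inr l] the loop at the end of the leg [inr l].    *)
Definition lstar_edge : finType := (leg + 'I_NB)%type.

(** Each leg starts at 0 at its outer end, where [C] and [S] take the values 1 and 0. A loop is
    centered at 0, so that parity separates its even and odd functions. *)
Definition lstar_position (p : lstar_edge * bool) : R :=
  match p with
  | (inl (inl (inl _)), b) => if b then 2 else 0
  | (inl _, b) => if b then 1 else 0
  | (inr _, b) => if b then 2 else -2
  end.

(* [None] is the center and [Some h] the other end of the leg [h]. *)
Definition lstar_vertex (p : lstar_edge * bool) : option leg :=
  match p with
  | (inl h, b) => if b then None else Some h
  | (inr l, _) => Some (inr l)
  end.

Lemma lstar_position_lt e :
  lstar_position (e, false) < lstar_position (e, true).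
Proof. by case: e => [[[]|]|] //= _; lra. Qed.

Definition lstar_glued : rel (lstar_edge * bool) :=
  [rel p q | lstar_vertex p == lstar_vertex q].

Lemma lstar_glued_equiv : equivalence_rel lstar_glued.
Proof. by move=> p q r; rewrite /lstar_glued /=; split=> // /eqP ->. Qed.

Definition lstar : metric_graph R :=
  MetricGraph lstar_position_lt lstar_glued_equiv.

Definition vset (w : option leg) : {set endpoint lstar} :=
  [set p : endpoint lstar | lstar_vertex p == w]%SET.

Definition dirichlet_ends : {set {set endpoint lstar}} :=
  [set vset (Some (inl (inl i))) | i : 'I_ND]%SET.

Lemma sum_vset (V : nmodType) (F : endpoint lstar -> V) w :
  \sum_(p in vset w) F p =
  \sum_(h : leg) ((if Some h == w then F (inl h, false) else 0) +
                  (if None == w then F (inl h, true) else 0)) +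
  \sum_(l < NB) (if Some (inr l : leg) == w
                 then F (inr l, false) + F (inr l, true) else 0).
Proof.
rewrite big_mkcond/=.
transitivity (\sum_(e : lstar_edge) \sum_(b : bool)
    (if (e, b) \in vset w then F (e, b) else 0)).
  by rewrite pair_bigA/=; apply: eq_bigr => -[e b] _.
rewrite big_sumType/=; congr (_ + _); apply: eq_bigr => i _.
  by rewrite big_bool/= !inE /= addrC.
by rewrite big_bool/= !inE /=; case: ifP => // _; rewrite ?addr0// addrC.
Qed.

Lemma sum_vset_end (V : nmodType) (F : endpoint lstar -> V) h :
  \sum_(p in vset (Some h)) F p = F (inl h, false) +
    match h with
    | inl _ => 0
    | inr l => F (inr l, false) + F (inr l, true)
    end.
Proof.
rewrite sum_vset (bigD1 h)//= eqxx addr0 big1 => [|h' h'h]; last first.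
  by rewrite (inj_eq Some_inj) (negbTE h'h) addr0.
rewrite addr0; congr (_ + _); case: h => [h|l]; first by rewrite big1.
rewrite (bigD1 l)//= eqxx big1 ?addr0// => l' l'l.
by rewrite (inj_eq Some_inj) (inj_eq inr_inj) (negbTE l'l).
Qed.

Lemma sum_vset_center (V : nmodType) (F : endpoint lstar -> V) :
  \sum_(p in vset None) F p = \sum_(h : leg) F (inl h, true).
Proof.
rewrite sum_vset [X in _ + X]big1//= addr0.
by apply: eq_bigr => h _; rewrite add0r.
Qed.

Hypothesis deg_center : (1 < #|leg|)%N.

Lemma vset_neq0 w : exists p, p \in vset w.
Proof.
case: w => [h|]; first by exists (inl h, false); rewrite inE.
have /card_gt0P[h _] := ltnW deg_center.
by exists (inl h, true); rewrite inE.
Qed.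

Lemma vset_inj : injective vset.
Proof.
move=> w w' ww'; have [p pw] := vset_neq0 w.
by have := pw; rewrite ww' !inE => /eqP <-; move: pw; rewrite inE => /eqP.
Qed.

Lemma lstar_verticesP v : reflect (exists w, v = vset w) (v \in vertices lstar).
Proof.
apply: (iffP imsetP) => [[p _ ->]|[w ->]].
  exists (lstar_vertex p); apply/setP => q; rewrite !inE/=.
  by rewrite /lstar_glued /= eq_sym.
have [p pw] := vset_neq0 w; exists p => //; apply/setP => q.
move: pw; rewrite !inE /= => /eqP <-; exact: eq_sym.
Qed.

Lemma degree_vset w : degree (vset w) =
  match w with None => #|leg| | Some (inl _) => 1%N | Some (inr _) => 3 end.
Proof.
(* The degree is a sum of ones, to which the formulas for sums over a vertex apply. *)
apply/eqP; rewrite -(@eqr_nat int) -sumr_const; case: w => [h|].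
  by rewrite sum_vset_end; case: h.
by rewrite sum_vset_center sumr_const.
Qed.

Lemma lstar_pendants :
  pendants lstar = [set vset (Some (inl h)) | h : 'I_ND + 'I_NN]%SET.
Proof.
apply/setP => v; rewrite inE; apply/andP/imsetP.
  move=> [/lstar_verticesP[w ->]]; rewrite degree_vset.
  case: w => [[h|l]|]//; first by exists h.
  by move=> /eqP E; move: deg_center; rewrite E.
move=> [h _ ->]; rewrite degree_vset; split=> //.
by apply/lstar_verticesP; exists (Some (inl h)).
Qed.

Lemma dirichlet_ends_sub : dirichlet_ends \subset pendants lstar.
Proof.
rewrite lstar_pendants; apply/fintype.subsetP => v /imsetP[i _ ->].
by apply/imsetP; exists (inl i).
Qed.

Lemma card_dirichlet_ends : #|dirichlet_ends| = ND.
Proof.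
rewrite card_imset ?cardsT ?card_ord//.
by move=> i j /vset_inj[].
Qed.

Lemma card_pendants : #|pendants lstar| = (ND + NN)%N.
Proof.
rewrite lstar_pendants card_imset ?cardsT ?card_sum ?card_ord//.
by move=> i j /vset_inj[].
Qed.

Lemma card_neumann : #|(pendants lstar :\: dirichlet_ends)%SET| = NN.
Proof.
rewrite cardsD (finset.setIidPr dirichlet_ends_sub) card_pendants.
by rewrite card_dirichlet_ends addKn.
Qed.

Lemma card_leg : #|leg| = (ND + NN + NB)%N.
Proof. by rewrite !card_sum !card_ord. Qed.

(** There are [#|leg| + NB] edges and [#|leg| + 1] vertices. *)
Lemma lstar_betti : betti lstar = NB%:Z.
Proof.
rewrite /betti.
have -> : vertices lstar = [set vset w | w in [set: option leg]]%SET.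
  apply/setP => v; apply/lstar_verticesP/imsetP => [[w ->]|[w _ ->]].
    by exists w.
  by exists w.
rewrite card_imset; last exact: vset_inj.
rewrite cardsT card_option card_sum card_leg card_ord; lia.
Qed.

Lemma lstar_connected : connected_graph lstar.
Proof.
split; first by rewrite card_sum (leq_trans (ltnW deg_center))// leq_addr.
have sym : connect_sym (@Defs.adjacent R lstar).
  by apply: sym_connect_sym => p q; congr orb; exact: eq_sym.
have /card_gt0P[h0 _] := ltnW deg_center.
have leg_center h b :
    connect (@Defs.adjacent R lstar) (inl h, b) (inl h0, true).
  apply: (@connect_trans _ _ (inl h, true)); apply: connect1.
    by apply/orP; right; exact: eqxx.
  by apply/orP; left; exact: eqxx.
have to_center p : connect (@Defs.adjacent R lstar) p (inl h0, true).
  case: p => -[h|l] b; first exact: leg_center.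
  apply: connect_trans (leg_center (inr l) false); apply: connect1.
  by apply/orP; left; exact: eqxx.
move=> p q; apply: connect_trans (to_center p) _.
by rewrite sym.
Qed.

Lemma lstar_length : total_length lstar = (2 * ND + NN + 5 * NB)%N%:R.
Proof.
rewrite /total_length !big_sumType/=.
rewrite !big_const_ord !iter_addr_0 natrD natrD !natrM.
rewrite -(mulr_natr (2 - 0)) -(mulr_natr (2 - -2)).
rewrite -(mulr_natr (1 - 0) NN) -(mulr_natr (1 - 0) NB); ring.
Qed.

End LollipopStar.

(** * Eigenspaces of the lollipop star *)

Section LollipopStarSpectrum.
Variables (R : realType) (ND NN NB : nat) (lam : R) (C S : R -> R).
Hypothesis CS : fundamental lam C S.
Hypothesis deg_center : (1 < #|leg ND NN NB|)%N.

Local Notation leg := (leg ND NN NB).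
Local Notation G := (lstar R ND NN NB).
Local Notation edges := (lstar_edge ND NN NB).

Definition leg_alpha (h : leg) : R :=
  match h with
  | inl (inl _) => S 2
  | inl (inr _) => C 1
  | inr _ => C 2 * C 1 - 2 * lam * S 2 * S 1
  end.

Definition leg_gamma (h : leg) : R :=
  match h with
  | inl (inl _) => - C 2
  | inl (inr _) => lam * S 1
  | inr _ => lam * (C 2 * S 1 + 2 * S 2 * C 1)
  end.

(* On the leg [h] the function is determined by one number [x h], read off at *)
(* the end away from the center; each loop carries moreover the odd function  *)
(* [r l * S], which is decoupled from the rest of the graph.                  *)
Definition coefC (x : leg -> R) (e : edges) : R :=
  match e with
  | inl (inl (inl _)) => 0
  | inl (inl (inr j)) => x (inl (inr j))
  | inl (inr l) => C 2 * x (inr l)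
  | inr l => x (inr l)
  end.

Definition coefS (x : leg -> R) (r : 'I_NB -> R) (e : edges) : R :=
  match e with
  | inl (inl (inl i)) => x (inl (inl i))
  | inl (inl (inr _)) => 0
  | inl (inr l) => - 2 * lam * S 2 * x (inr l)
  | inr l => r l
  end.

Let C0 := fund_C0 CS.
Let S0 := fund_S0 CS.

Lemma kirchhoff_end (p q : edges -> R) h :
  \sum_(s in vset R (Some h)) inward_derivative (@dcomb _ G lam C S p q) s =
  q (inl h) + match h with inl _ => 0 | inr l => 2 * lam * p (inr l) * S 2 end.
Proof.
rewrite sum_vset_end; congr (_ + _).
  rewrite /inward_derivative /at_endpoint /dcomb expr0 mul1r /=.
  by case: h => [[i|j]|l] /=; rewrite C0 S0; ring.
case: h => [//|l]; rewrite /inward_derivative /at_endpoint /dcomb /=.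
rewrite (fund_even CS) (fund_odd CS); ring.
Qed.

Lemma kirchhoff_center (p q : edges -> R) :
  \sum_(s in vset R None) inward_derivative (@dcomb _ G lam C S p q) s =
  \sum_(h : leg)
    - (@dcomb _ G lam C S p q (inl h) (lstar_position R (inl h, true))).
Proof.
rewrite sum_vset_center; apply: eq_bigr => h _.
by rewrite /inward_derivative /at_endpoint expr1 mulN1r.
Qed.

Lemma coef_center x r h : let t := lstar_position R (inl h, true) in
  @comb _ G C S (coefC x) (coefS x r) (inl h) t = leg_alpha h * x h /\
  - @dcomb _ G lam C S (coefC x) (coefS x r) (inl h) t = leg_gamma h * x h.
Proof.
rewrite /comb /dcomb; case: h => [[i|j]|l] /=; split; ring.
Qed.

(** The conditions at the outer ends and at the feet of the loops determine every coefficient from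
    [x] and [r]. Continuity and Kirchhoff at the center are then exactly the star system for [x]. *)
Lemma lstar_eigenspaceP f :
  in_eigenspace (dirichlet_ends R ND NN NB) lam f <->
  exists x r, [/\ star_solution leg_alpha leg_gamma x,
    forall l, r l * S 2 = 0 &
    eq_on_graph f (@comb _ G C S (coefC x) (coefS x r))].
Proof.
have notD w : (forall i, w <> Some (inl (inl i))) ->
    vset R w \notin dirichlet_ends R ND NN NB.
  move=> wD; apply/imsetP => -[i _ /(vset_inj deg_center)]; exact: wD.
have vertexG w : vset R w \in vertices G.
  by apply/lstar_verticesP => //; exists w.
split; last first.
  move=> [x [r [[[z uz] us] rS fE]]]; apply/(in_eigenspaceP _ CS).
  exists (coefC x), (coefS x r); split=> //.
  - pose val (w : option leg) : R := match w with
      | None => z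
      | Some (inl (inl _)) => 0
      | Some (inl (inr j)) => x (inl (inr j))
      | Some (inr l) => C 2 * x (inr l) end.
    have valE s : at_endpoint (@comb _ G C S (coefC x) (coefS x r)) s =
        val (lstar_vertex s).
      case: s => -[h|l] [].
      + by rewrite /at_endpoint /= (coef_center x r h).1 uz.
      + rewrite /at_endpoint /comb.
        by case: h => [[i|j]|l] /=; rewrite C0 S0; ring.
      + rewrite /at_endpoint /comb /= rS; ring.
      + rewrite /at_endpoint /comb /= (fund_odd CS) (fund_even CS) mulrN rS.
        ring.
    by move=> s s' /eqP ss'; rewrite !valE ss'.
  - move=> v s /imsetP[i _ ->]; rewrite inE => /eqP.
    case: s => -[h|l] [] //= [->].
    by rewrite /at_endpoint /comb /= S0; ring.
  - move=> v /lstar_verticesP => /(_ deg_center)[w ->].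
    case: w => [h|] vD.
      rewrite kirchhoff_end; case: h vD => [[i|j]|l] vD /=; last 2 first.
      + by rewrite addr0.
      + ring.
      by case/negP: vD; apply/imsetP; exists i.
    rewrite kirchhoff_center -[RHS]us; apply: eq_bigr => h _.
    by rewrite (coef_center x r h).2.
move=> /(in_eigenspaceP _ CS)[p [q [fE gl dir kir]]].
pose x (h : leg) : R := match h with
  | inl (inl _) => q (inl h)
  | inl (inr _) => p (inl h)
  | inr l => p (inr l)
  end.
pose r l : R := q (inr l).
have glv (s s' : endpoint G) : lstar_vertex s = lstar_vertex s' ->
    at_endpoint (@comb _ G C S p q) s = at_endpoint (@comb _ G C S p q) s'.
  by move=> ss'; apply: gl; exact/eqP.
(* The ends [-2] and [2] of a loop are glued, so its odd part vanishes there. *)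
have rS l : r l * S 2 = 0.
  have := glv (inr l, false) (inr l, true) erefl.
  rewrite /at_endpoint /comb /= (fund_odd CS) (fund_even CS) /r; lra.
have pE e : p e = coefC x e.
  case: e => [[[i|j]|l]|l] //=.
    have /(_ (vset R (Some (inl (inl i)))) (inl (inl (inl i)), false)) := dir.
    rewrite /at_endpoint /comb /= C0 S0 mulr1 mulr0 addr0; apply.
      by apply/imsetP; exists i.
    by rewrite inE.
  have := glv (inl (inr l), false) (inr l, true) erefl.
  rewrite /at_endpoint /comb /= C0 S0 -/(r l) rS /x => E; lra.
have qE e : q e = coefS x r e.
  case: e => [[[i|j]|l]|l] //=.
    have := kir _ (vertexG (Some (inl (inr j)))) (notD _ _).
    by rewrite kirchhoff_end addr0; apply.
  have := kir _ (vertexG (Some (inr l))) (notD _ _).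
  rewrite kirchhoff_end /x => H.
  by have {H} := H (fun _ => ltac:(discriminate)); lra.
have combE e t : @comb _ G C S p q e t =
    @comb _ G C S (coefC x) (coefS x r) e t.
  by rewrite /comb pE qE.
have dcombE e t : @dcomb _ G lam C S p q e t =
    @dcomb _ G lam C S (coefC x) (coefS x r) e t.
  by rewrite /dcomb pE qE.
exists x, r; split=> //; last by move=> e t et; rewrite (fE e t et).
split.
  have /card_gt0P[h0 _] := ltnW deg_center.
  exists (leg_alpha h0 * x h0) => h.
  rewrite -(coef_center x r h).1 -(coef_center x r h0).1 -!combE.
  exact: glv (inl h, true) (inl h0, true) erefl.
have := kir _ (vertexG None) (notD _ _); rewrite kirchhoff_center => H.
rewrite -[RHS]H//; apply: eq_bigr => h _.
by rewrite dcombE (coef_center x r h).2.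
Qed.

(** The eigenspace is the direct sum of the solutions of the star system and of the odd functions on
    the loops, whence a block diagonal matrix. *)
Lemma lstar_multiplicity :
  (forall h, leg_alpha h = 0 -> leg_gamma h != 0) ->
  has_multiplicity (dirichlet_ends R ND NN NB) lam
    (star_dim leg_alpha leg_gamma + (if S 2 == 0 then NB else 0)).
Proof.
move=> ag.
have [X [Xf XP]] := star_solution_space (ltnW deg_center) ag.
have [Y [Yf YP]] : exists Y : 'M[R]_(if S 2 == 0 then NB else 0, NB),
    row_free Y /\ forall r : 'rV_NB, (r <= Y)%MS <-> forall l, r 0 l * S 2 = 0.
  case: eqP => [S20|/eqP S20].
    exists 1%:M; rewrite row_free_unit unitmx1; split=> // r.
    by rewrite submx1; split=> // _ l; rewrite S20 mulr0.
  exists (0 : 'M[R]_(0, NB)); split; first by rewrite /row_free mxrank0.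
  move=> r; split=> [/submx0null-> l|rS]; first by rewrite mxE mul0r.
  rewrite (_ : r = 0) ?sub0mx//; apply/rowP => l; rewrite mxE.
  by have /eqP := rS l; rewrite mulf_eq0 (negbTE S20) orbF => /eqP.
pose xs (u : 'rV[R]_(#|leg| + NB)) (h : leg) := lsubmx u 0 (enum_rank h).
pose rs (u : 'rV[R]_(#|leg| + NB)) (l : 'I_NB) := rsubmx u 0 l.
pose Phi u := @comb _ G C S (coefC (xs u)) (coefS (xs u) (rs u)).
have subP (u : 'rV_(#|leg| + NB)) : (u <= block_mx X 0 0 Y)%MS <->
    (lsubmx u <= X)%MS /\ (rsubmx u <= Y)%MS.
  split.
    move=> /submxP[c ->]; rewrite -[c]hsubmxK mul_row_block !mulmx0 addr0 add0r.
    by rewrite row_mxKl row_mxKr; split; exact: submxMl.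
  move=> [/submxP[c cE] /submxP[d dE]]; apply/submxP; exists (row_mx c d).
  by rewrite mul_row_block !mulmx0 addr0 add0r -cE -dE hsubmxK.
apply: (@has_multiplicity_param _ _ _ _ _ _ (block_mx X 0 0 Y) Phi).
- by rewrite /row_free rank_diag_block_mx (eqP Xf) (eqP Yf).
- move=> a u v e t; rewrite /Phi /comb /xs /rs.
  case: e => [[[i|j]|l]|l] /=; rewrite ?linearP/= !mxE; ring.
- move=> u v uv.
  have pqE e : coefC (xs u) e = coefC (xs v) e /\
      coefS (xs u) (rs u) e = coefS (xs v) (rs v) e.
    have H : {in `[lstar_position R (e, false), lstar_position R (e, true)],
      forall t, (coefC (xs u) e - coefC (xs v) e) * C t +
        (coefS (xs u) (rs u) e - coefS (xs v) (rs v) e) * S t = 0}.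
      move=> t /uv; rewrite /Phi /comb => E; lra.
    by have [/subr0_eq -> /subr0_eq ->] :=
      fund_free CS (lstar_position_lt R e) H.
  rewrite -[u]hsubmxK -[v]hsubmxK; congr row_mx; apply/rowP => k.
    rewrite -[k]enum_valK -/(xs u _) -/(xs v _).
    case: (enum_val k) => [[i|j]|l].
    + exact: (pqE (inl (inl (inl i)))).2.
    + exact: (pqE (inl (inl (inr j)))).1.
    + exact: (pqE (inr l)).1.
  exact: (pqE (inr k)).2.
move=> f; split.
  move=> /lstar_eigenspaceP[x [r [xsol rS fE]]].
  pose u : 'rV[R]_(#|leg| + NB) :=
    row_mx (\row_k x (enum_val k)) (\row_l r l).
  have xu : xs u = x.
    by apply/funext => h; rewrite /xs row_mxKl mxE enum_rankK.
  have ru : rs u = r by apply/funext => l; rewrite /rs row_mxKr mxE.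
  exists u; split; last by rewrite /Phi xu ru.
  apply/subP; split.
    by apply/XP; rewrite -/(xs u) xu.
  by apply/YP => l; rewrite -/(rs u l) ru.
move=> [u [/subP[/XP ux /YP ur] fE]].
by apply/lstar_eigenspaceP; exists (xs u), (rs u).
Qed.

End LollipopStarSpectrum.

(** * Multiplicities as a function of [lam] *)

Section StarDim.
Variables (R : realType) (ND NN NB : nat).
Local Notation leg := (leg ND NN NB).

Lemma sum_leg (V : nmodType) (a b c : V) (f : leg -> V) :
  (forall i, f (inl (inl i)) = a) -> (forall j, f (inl (inr j)) = b) ->
  (forall l, f (inr l) = c) ->
  \sum_h f h = a *+ ND + b *+ NN + c *+ NB.
Proof.
move=> fa fb fc; rewrite !big_sumType /=.
rewrite (eq_bigr (fun=> a)) 1?[X in _ + X + _](eq_bigr (fun=> b))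
  1?[X in _ + _ + X](eq_bigr (fun=> c)) //.
by rewrite !sumr_const !card_ord.
Qed.

Lemma card_leg_pred (P : pred leg) (a b c : bool) :
  (forall i, P (inl (inl i)) = a) -> (forall j, P (inl (inr j)) = b) ->
  (forall l, P (inr l) = c) ->
  #|P| = (a * ND + b * NN + c * NB)%N.
Proof.
move=> Pa Pb Pc; rewrite -sum1_card big_mkcond /= !big_sumType /=.
have PE h : (if h \in P then 1 else 0)%N = P h.
  by rewrite -topredE /=; case: (P h).
rewrite (eq_bigr (fun=> nat_of_bool a)) => [|i _]; last by rewrite PE Pa.
rewrite [X in (_ + X + _)%N](eq_bigr (fun=> nat_of_bool b)) => [|j _];
  last by rewrite PE Pb.
rewrite [X in (_ + _ + X)%N](eq_bigr (fun=> nat_of_bool c)) => [|l _];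
  last by rewrite PE Pc.
by rewrite !sum_nat_const !card_ord mulnC [(NN * _)%N]mulnC [(NB * _)%N]mulnC.
Qed.

Variables (lam : R) (C S : R -> R).
Hypothesis CS : fundamental lam C S.
Local Notation alpha := (@leg_alpha R ND NN NB lam C S).
Local Notation gam := (@leg_gamma R ND NN NB lam C S).

(** On a leg, [alpha] and [gam] are, up to sign, the value and the derivative at the center of a
    nonzero solution, which cannot both vanish. *)
Lemma leg_nondegenerate : lam != 0 -> forall h, alpha h = 0 -> gam h != 0.
Proof.
move=> lam0; have N1 := fund_norm CS 1; have N2 := fund_norm CS 2.
case=> [[i|j]|l] /= a0; apply/eqP => g0.
- have : 1 = 0 :> R by rewrite -N2 a0 -[C 2]opprK g0; ring.
  by move/eqP; rewrite oner_eq0.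
- have S1 : S 1 = 0 by move/eqP: g0; rewrite mulf_eq0 (negbTE lam0) => /eqP.
  have : 1 = 0 :> R by rewrite -N1 a0 S1; ring.
  by move/eqP; rewrite oner_eq0.
- move/eqP: g0; rewrite mulf_eq0 (negbTE lam0) => /eqP g0.
  (* The two identities that follow propagate zero data back along the stick, whose transfer matrix
     has determinant [C 1 ^+ 2 + lam * S 1 ^+ 2 = 1]. They give [C 2 = 0] and [lam * S 2 = 0],
     against [fund_norm] at 2. *)
  have C20 : C 2 = 0.
    transitivity (C 2 * (C 1 ^+ 2 + lam * S 1 ^+ 2)); first by rewrite N1 mulr1.
    transitivity ((C 2 * C 1 - 2 * lam * S 2 * S 1) * C 1 +
      lam * S 1 * (C 2 * S 1 + 2 * S 2 * C 1)); first ring.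
    by rewrite a0 g0; ring.
  have S20 : lam * S 2 = 0.
    have : 2 * (lam * S 2) * (C 1 ^+ 2 + lam * S 1 ^+ 2) = 0.
      transitivity (lam * (C 2 * S 1 + 2 * S 2 * C 1) * C 1 -
        (C 2 * C 1 - 2 * lam * S 2 * S 1) * (lam * S 1)); first ring.
      by rewrite a0 g0; ring.
    by rewrite N1; lra.
  have : 1 = 0 :> R.
    rewrite -N2 C20 expr2 [S 2 ^+ 2]expr2 (mulrA lam) S20; ring.
  by move/eqP; rewrite oner_eq0.
Qed.

End StarDim.

Section Multiplicities.
Variables (R : realType) (ND NN NB : nat).
Hypothesis legs_gt1 : (1 < ND + NN + NB)%N.
Local Notation G := (lstar R ND NN NB).
Local Notation D := (dirichlet_ends R ND NN NB).

Let deg_center : (1 < #|leg ND NN NB|)%N.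
Proof. by rewrite card_leg. Qed.

(** All [alpha] are positive and all [gam] negative, so the sum of the quotients is not 0. *)
Lemma multiplicity_neg (lam : R) : lam < 0 -> has_multiplicity D lam 0.
Proof.
move=> lam0; pose k := Num.sqrt (- lam).
have k0 : 0 < k by rewrite sqrtr_gt0 oppr_gt0.
have -> : lam = - k ^+ 2 by rewrite sqr_sqrtr ?opprK// oppr_ge0 ltW.
set lam' := - k ^+ 2; have lam'0 : lam' < 0 by rewrite oppr_lt0 exprn_gt0.
have CS := fundamental_neg k0.
set C := fun x => _ in CS; set S := (X in fundamental _ _ X) in CS.
have C_gt0 x : 0 < C x by rewrite divr_gt0 ?addr_gt0 ?expR_gt0.
have S_gt0 x : 0 < x -> 0 < S x.
  move=> x0; apply: divr_gt0; last by rewrite mulr_gt0.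
  by rewrite subr_gt0 ltr_expR mulNr -subr_gt0 opprK addr_gt0// mulr_gt0.
have C1 := C_gt0 1; have C2 := C_gt0 2.
have S1 := S_gt0 1 ltr01; have S2 := S_gt0 2 (ltr0Sn R 1).
have aP h : 0 < @leg_alpha R ND NN NB lam' C S h.
  case: h => [[i|j]|l] //=; rewrite subr_gt0.
  apply: (@lt_trans _ _ 0); last exact: mulr_gt0.
  rewrite -mulrA -[2 * _ * _]mulrA pmulr_rlt0// nmulr_rlt0//.
  exact: mulr_gt0.
have gN h : @leg_gamma R ND NN NB lam' C S h < 0.
  case: h => [[i|j]|l] /=; rewrite ?oppr_lt0// nmulr_rlt0//.
  by apply: addr_gt0; [exact: mulr_gt0|apply: mulr_gt0 => //; exact: mulr_gt0].
have := lstar_multiplicity CS deg_center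
  (leg_nondegenerate CS (negbT (lt_eqF lam'0))).
rewrite gt_eqF// addn0 /star_dim eq_card0; last first.
  by move=> h; rewrite -topredE /= gt_eqF.
rewrite eqxx lt_eqF//.
have /card_gt0P[h0 _] := ltnW deg_center.
have q0 h :
    @leg_gamma R ND NN NB lam' C S h / @leg_alpha R ND NN NB lam' C S h < 0.
  by rewrite pmulr_llt0 ?invr_gt0.
rewrite (bigD1 h0)//=; apply: (@lt_le_trans _ _ (0 + 0)); last by rewrite addr0.
apply: ltr_leD => //; apply: sumr_le0 => h _; exact: ltW.
Qed.

(** No [alpha] vanishes and the sum of the quotients is [- ND / 2]; no odd function is admissible
    since [S 2 = 2]. *)
Lemma multiplicity0 : has_multiplicity D (0 : R) (ND == 0%N).
Proof.
have CS := fundamental0 R.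
have an0 h : @leg_alpha R ND NN NB 0 (cst 1) id h != 0.
  by case: h => [[i|j]|l] /=; rewrite ?pnatr_eq0 ?oner_eq0.
have H h : @leg_alpha R ND NN NB 0 (cst 1) id h = 0 ->
    @leg_gamma R ND NN NB 0 (cst 1) id h != 0.
  by move=> a0; have := an0 h; rewrite a0 eqxx.
have := lstar_multiplicity CS deg_center H.
rewrite /= pnatr_eq0 /= addn0 /star_dim eq_card0; last first.
  by move=> h; rewrite -topredE /= (negbTE (an0 h)).
rewrite eqxx (@sum_leg _ _ _ _ (- 1 / 2) 0 0); first last.
- by move=> l /=; rewrite !mul0r.
- by move=> j /=; rewrite !mul0r.
- by [].
rewrite !mul0rn !addr0 -[_ *+ ND]mulr_natr mulf_eq0 pnatr_eq0 mulf_eq0 invr_eq0.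
by rewrite pnatr_eq0 oppr_eq0 oner_eq0.
Qed.

(* [sum_h gam h / alpha h] at [lam = k ^+ 2] in terms of [y = sin k ^+ 2], up *)
(* to a factor which vanishes nowhere but where some [alpha h] does; the      *)
(* factor [1 - 6 y] of [alpha] comes from the lollipops.                      *)
Definition secular (y : R) : R :=
  if NB == 0%N then 2 * NN%:R * y - ND%:R * (1 - 2 * y) else
  2 * NN%:R * y * (1 - 6 * y) - ND%:R * (1 - 2 * y) * (1 - 6 * y)
  + 2 * NB%:R * y * (5 - 6 * y).

(* The multiplicity of [k ^+ 2], for [0 < k], when [y = sin k ^+ 2]. *)
Definition ymult (y : R) : nat :=
  if y == 0 then ((if ND == 0%N then 1 else ND.-1) + NB)%N
  else if y == 1 then (ND + NN + NB + NB).-1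
  else if (y == 6^-1) && (0 < NB)%N then NB.-1
  else secular y == 0.

(** With [s = sin k] and [c = cos k], the [alpha] are [2 s c / k], [c] and [c (1 - 6 y)]. They all
    vanish if [c = 0], those of the Dirichlet legs alone if [s = 0], those of the lollipops alone if
    [y = 1/6]. Odd functions on the loops appear exactly when [s c = 0]. *)
Lemma multiplicity_pos (k : R) : 0 < k ->
  has_multiplicity D (k ^+ 2) (ymult (sin k ^+ 2)).
Proof.
move=> k0; pose C x := cos (k * x); pose S x := sin (k * x) / k.
have CS : fundamental (k ^+ 2) C S := fundamental_pos k0.
have kn0 : k != 0 by rewrite gt_eqF.
have := lstar_multiplicity CS deg_center
  (leg_nondegenerate CS (negbT (gt_eqF (exprn_gt0 2 k0)))).
set c := cos k; set s := sin k; set y := s ^+ 2.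
have cs : c ^+ 2 = 1 - y by rewrite cos2sin2.
have C1 : C 1 = c by rewrite /C mulr1.
have S1 : S 1 = s / k by rewrite /S mulr1.
have C2 : C 2 = 1 - 2 * y.
  rewrite /C (_ : k * 2 = k *+ 2) ?mulr_natr// cos_mulr2n -/c cs; ring.
have S2 : S 2 = 2 * (s * c) / k.
  rewrite /S (_ : k * 2 = k *+ 2) ?mulr_natr// sin_mulr2n -/c -/s.
  by congr (_ / _); ring.
have aD i : @leg_alpha R ND NN NB (k ^+ 2) C S (inl (inl i)) = 2 * (s * c) / k.
  by [].
have aN j : @leg_alpha R ND NN NB (k ^+ 2) C S (inl (inr j)) = c by [].
have aL l : @leg_alpha R ND NN NB (k ^+ 2) C S (inr l) = c * (1 - 6 * y).
  by rewrite /= C1 S1 C2 S2 /y; field.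
have gD i : @leg_gamma R ND NN NB (k ^+ 2) C S (inl (inl i)) = - (1 - 2 * y).
  by rewrite /= C2.
have gN j : @leg_gamma R ND NN NB (k ^+ 2) C S (inl (inr j)) = k * s.
  by rewrite /= S1; field.
have gL l : @leg_gamma R ND NN NB (k ^+ 2) C S (inr l) = k * s * (5 - 6 * y).
  transitivity (k * s * (1 - 2 * y + 4 * c ^+ 2)); last by rewrite cs; ring.
  by rewrite /= C1 S1 C2 S2; field.
have y0 : (y == 0) = (s == 0) by rewrite sqrf_eq0.
have y1 : (y == 1) = (c == 0) by rewrite -(sqrf_eq0 c) cs subr_eq0 eq_sym.
have y6 : (1 - 6 * y == 0) = (y == 6^-1).
  by apply/eqP/eqP => [H|->]; [lra|field].
have two0 : (2 : R) == 0 = false by rewrite pnatr_eq0.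
have SD : (2 * (s * c) / k == 0) = (s == 0) || (c == 0).
  by rewrite !mulf_eq0 invr_eq0 (negbTE kn0) two0 orbF.
rewrite S2 SD /ymult y0 y1 /star_dim.
rewrite (@card_leg_pred _ _ _ _ ((s == 0) || (c == 0)) (c == 0)
  ((c == 0) || (y == 6^-1))); first last.
- by move=> l; rewrite -y6 -mulf_eq0 -(aL l).
- by move=> j; rewrite -(aN j).
- by move=> i; rewrite -SD -(aD i).
have [s0|s0] /= := eqVneq s 0.
  have yE : y = 0 by rewrite /y s0 expr0n.
  have c0 : c == 0 = false.
    by apply/negbTE; rewrite -sqrf_eq0 cs yE subr0 oner_eq0.
  have sixth : (0 : R) == 6^-1 = false by rewrite eq_sym invr_eq0 pnatr_eq0.
  rewrite c0 yE sixth /= mul1n !mul0n !addn0; case: (ND == 0%N) => //.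
  (* The Dirichlet summands are 0 by the convention [0^-1 = 0]; the others carry the factor
     [s = 0]. *)
  rewrite big1 ?eqxx// => -[[i|j]|l] _.
  - by rewrite aD s0 mul0r mulr0 mul0r invr0 mulr0.
  - by rewrite gN s0 mulr0 mul0r.
  - by rewrite gL s0 mulr0 !mul0r.
have [c0|c0] /= := eqVneq c 0.
  rewrite !mul1n gtn_eqF ?(ltn_trans _ legs_gt1)//.
  by move: legs_gt1; case: (ND + NN + NB)%N.
rewrite !mul0n !add0n addn0; case: (eqVneq y 6^-1) => [yE|yn] /=; last first.
  congr (has_multiplicity _ _ (nat_of_bool _)).
  have y6n : 1 - 6 * y != 0 by rewrite y6.
  rewrite (@sum_leg _ _ _ _ (- (1 - 2 * y) / (2 * (s * c) / k))
    (k * s / c) (k * s * (5 - 6 * y) / (c * (1 - 6 * y)))).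
  - rewrite -[_ *+ ND]mulr_natr -[_ *+ NN]mulr_natr -[_ *+ NB]mulr_natr.
    set F := (X in X == 0).
    have [NB0|NB0] := eqVneq NB 0%N.
      have -> : secular y = F * (2 * (s * c) / k).
        rewrite /secular /F NB0 eqxx /y; field.
        by rewrite c0 kn0 -/y y6n s0.
      by rewrite mulf_eq0 SD (negbTE s0) (negbTE c0) !orbF.
    have -> : secular y = F * (2 * (s * c) / k) * (1 - 6 * y).
      rewrite /secular /F (negbTE NB0) /y; field.
      by rewrite c0 kn0 -/y y6n s0.
    by rewrite mulf_eq0 (negbTE y6n) mulf_eq0 SD (negbTE s0) (negbTE c0) !orbF.
  - by move=> i; rewrite aD gD.
  - by move=> j; rewrite aN gN.
  - by move=> l; rewrite aL gL.
(* Without lollipops, [y = 1/6] is not exceptional and [secular] still decides. *)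
rewrite mul1n; have [NB0|NB0] := posnP NB; last by [].
congr (has_multiplicity _ _ (nat_of_bool _)).
rewrite (@sum_leg _ _ _ _ (- (1 - 2 * y) / (2 * (s * c) / k)) (k * s / c) 0).
- rewrite -[_ *+ ND]mulr_natr -[_ *+ NN]mulr_natr mul0rn addr0.
  set F := (X in X == 0).
  have -> : secular y = F * (2 * (s * c) / k).
    by rewrite /secular /F NB0 eqxx /y; field; rewrite c0 kn0 s0.
  by rewrite mulf_eq0 SD (negbTE s0) (negbTE c0) !orbF.
- by move=> i; rewrite aD gD.
- by move=> j; rewrite aN gN.
- by move=> l; have := ltn_ord l; rewrite [X in (_ < X)%N]NB0.
Qed.

End Multiplicities.

(** * The eigenvalues of one period *)

Section Block.
Variables (R : realType) (ND NN NB : nat).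
Hypothesis legs_gt1 : (1 < ND + NN + NB)%N.
Local Notation ymult := (@ymult R ND NN NB).
Local Notation secular := (@secular R ND NN NB).

Lemma secular_quadratic y : (0 < NB)%N -> secular y =
  - (12 * (ND + NN + NB)%:R) * y ^+ 2
  + (8 * ND%:R + 2 * NN%:R + 10 * NB%:R) * y - ND%:R.
Proof. by rewrite /secular lt0n => /negbTE ->; rewrite !natrD; ring. Qed.

(* [secular] is negative at [1], positive at [1/6] and nonpositive at [0].    *)
Lemma secular_roots : (0 < NB)%N -> exists y1 y2 : R,
  [/\ 0 <= y1 < 6^-1, 6^-1 < y2 < 1, (y1 == 0) = (ND == 0%N)
    & forall y, (secular y == 0) = (y == y1) || (y == y2)].
Proof.
move=> NB0; set d : R := ND%:R; set n : R := NN%:R; set b : R := NB%:R.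
have d0 : 0 <= d by rewrite ler0n.
have n0 : 0 <= n by rewrite ler0n.
have b0 : 0 < b by rewrite ltr0n.
pose A := 12 * (d + n + b); pose B := 8 * d + 2 * n + 10 * b.
have sE y : secular y = - A * y ^+ 2 + B * y - d.
  by rewrite secular_quadratic// /A /B !natrD.
pose p : {poly R} := (- A)%:P * 'X^2 + B%:P * 'X - d%:P.
have pE y : p.[y] = secular y by rewrite sE /p !hornerE.
have s0 : secular 0 = - d by rewrite sE; ring.
have s6 : secular 6^-1 = 4 / 3 * b by rewrite sE /A /B; field.
have s1 : secular 1 = - (5 * d + 10 * n + 2 * b) by rewrite sE /A /B; ring.
have [||y1] := @poly_ivt R p 0 6^-1.
- by rewrite invr_ge0.
- by rewrite !pE s0 s6 oppr_le0 d0 mulr_ge0// ltW.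
move=> /andP[y10 y16]; rewrite rootE pE => /eqP sy1.
have [||y2] := @poly_ivt R (- p) 6^-1 1.
- by rewrite invf_le1// ler1n.
- by rewrite !hornerN !pE s1 s6 opprK; apply/andP; split; lra.
move=> /andP[y26 y21]; rewrite rootE hornerN oppr_eq0 pE => /eqP sy2.
have y16' : y1 < 6^-1.
  rewrite lt_neqAle y16 andbT; apply/eqP => E; move: sy1; rewrite E s6; lra.
have y26' : 6^-1 < y2.
  rewrite lt_neqAle y26 andbT; apply/eqP => E; move: sy2; rewrite -E s6; lra.
have y21' : y2 < 1.
  rewrite lt_neqAle y21 andbT; apply/eqP => E; move: sy2; rewrite E s1; lra.
have A0 : A != 0 by rewrite gt_eqF// /A; lra.
have y12 : y2 - y1 != 0 by rewrite subr_eq0 gt_eqF// (lt_trans y16').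
(* Vieta: subtract the equations of the two roots and divide by [y2 - y1]. The product of the roots
   then shows that [y1] is 0 exactly when [ND] is. *)
have BE : B = A * (y1 + y2).
  apply: (mulfI y12); rewrite !sE in sy1 sy2; apply/eqP; rewrite -subr_eq0.
  apply/eqP; transitivity ((- A * y2 ^+ 2 + B * y2 - d) -
    (- A * y1 ^+ 2 + B * y1 - d)); first ring.
  by rewrite sy1 sy2 subrr.
have dE : d = A * (y1 * y2).
  transitivity (A * (y1 * y2) - (- A * y1 ^+ 2 + A * (y1 + y2) * y1 - d)).
    ring.
  by rewrite -BE -sE sy1 subr0.
exists y1, y2; split; rewrite ?y10 ?y26' //.
- rewrite -(pnatr_eq0 R) -/d dE mulf_eq0 (negbTE A0) mulf_eq0 /=.
  rewrite [y2 == 0]gt_eqF ?orbF// (lt_trans _ y26')// invr_gt0//.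
- move=> y; have -> : secular y = - A * ((y - y1) * (y - y2)).
    by rewrite sE BE dE; ring.
  by rewrite mulf_eq0 oppr_eq0 (negbTE A0) mulf_eq0 !subr_eq0.
Qed.

(** Each [y] of the open unit interval comes from one [k] between 0 and [pi / 2], so [Y] encodes the
    eigenvalues of a quarter wave. Its size fixes the index at which the sharp eigenvalue begins. *)
Lemma quarter_values : exists Y : seq R,
  [/\ all (fun y : R => 0 < y < 1) Y, size Y = (NB + (0 < ND))%N &
    forall y : R, 0 < y < 1 -> count_mem y Y = ymult y].
Proof.
have ymultE (y : R) : 0 < y < 1 -> ymult y =
    if (y == 6^-1) && (0 < NB)%N then NB.-1 else (secular y == 0) : nat.
  by move=> /andP[y0 y1]; rewrite /ymult gt_eqF// lt_eqF.
have [NB0|NB0] := posnP NB.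
  have lin y : secular y =
      2 * (ND%:R + NN%:R) * y - ND%:R by rewrite /secular NB0 /=; ring.
  have [D0|D0] := posnP ND.
    exists [::]; split=> [//||y y01]; first by rewrite NB0.
    rewrite ymultE// lin [in (0 < NB)%N]NB0 andbF /= D0 subr0 add0r.
    rewrite mulf_eq0 mulf_eq0 !pnatr_eq0 /=.
    rewrite [y == 0]gt_eqF ?orbF; last by case/andP: y01.
    by rewrite gtn_eqF//; move: legs_gt1; rewrite NB0 D0; lia.
  have d0 : 0 < ND%:R :> R by rewrite ltr0n.
  have n0 : 0 <= NN%:R :> R by rewrite ler0n.
  pose y0 : R := ND%:R / (2 * (ND%:R + NN%:R)).
  have e0 : 0 < 2 * (ND%:R + NN%:R) :> R by lra.
  exists [:: y0]; split=> [||y y01].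
  - rewrite /= andbT divr_gt0//= ltr_pdivrMr// mul1r; lra.
  - by rewrite NB0.
  rewrite ymultE// lin [in (0 < NB)%N]NB0 andbF /= addn0 eq_sym.
  congr nat_of_bool.
  apply/eqP/eqP => [->|H]; rewrite /y0; first by field; rewrite gt_eqF//; lra.
  by apply: (mulfI (lt0r_neq0 e0)); rewrite mulrCA divff ?lt0r_neq0//; lra.
have [y1 [y2 [/andP[y10 y16] /andP[y26 y21] yD sE]]] := secular_roots NB0.
have six1 : (6^-1 : R) < 1 by rewrite invf_lt1// ltr1n.
have six0 : 0 < (6^-1 : R) by rewrite invr_gt0.
(* When [ND = 0] the root [y1] is 0 and leaves the open interval. *)
exists ((if ND == 0%N then [::] else [:: y1]) ++ nseq NB.-1 6^-1 ++ [:: y2]).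
split.
- rewrite !all_cat /= all_nseq six0 six1 orbT y21 (lt_trans six0 y26) /= andbT.
  rewrite -yD; case: eqVneq => //= y1n.
  by rewrite lt_neqAle eq_sym y1n y10 (lt_trans y16).
- by rewrite !size_cat size_nseq /= lt0n; case: (ND == 0%N) => /=; lia.
move=> y y01; rewrite ymultE// NB0 andbT sE !count_cat /= count_nseq addn0 /=.
have D1 : count_mem y (if ND == 0%N then [::] else [:: y1]) = (y == y1).
  rewrite -yD; case: (eqVneq y1 0) => [->|_] /=; last by rewrite addn0 eq_sym.
  by rewrite gt_eqF//; case/andP: y01.
rewrite {}D1 [6^-1 == y]eq_sym [y2 == y]eq_sym.
case: (eqVneq y 6^-1) => [->|y6] /=.
  by rewrite [_ == y1]gt_eqF// [_ == y2]lt_eqF// mul1n addn0.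
rewrite mul0n add0n; case: (eqVneq y y1) => [->|_] //=.
by rewrite lt_eqF// (lt_trans y16).
Qed.

Lemma sin_sqr_bij (t : R) : 0 < t < pi / 2 -> 0 < sin t ^+ 2 < 1 /\
  asin (Num.sqrt (sin t ^+ 2)) = t.
Proof.
move=> t01; have s0 := sin_gt0_pihalf t01; have /andP[t0 tpi] := t01.
have c0 : 0 < cos t by apply: cos_gt0_pihalf; rewrite tpi andbT; lra.
split; first by rewrite exprn_gt0//= sin2cos2 ltrBlDr ltrDl exprn_gt0.
by rewrite sqrtr_sqr ger0_norm ?ltW// sinK// in_itv/= ltW//=; lra.
Qed.

Lemma asin_sqrt_bij (y : R) : 0 < y < 1 ->
  0 < asin (Num.sqrt y) < pi / 2 /\ sin (asin (Num.sqrt y)) ^+ 2 = y.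
Proof.
move=> /andP[y0 y1]; have q0 : 0 < Num.sqrt y by rewrite sqrtr_gt0.
have q1 : Num.sqrt y < 1 by rewrite -sqrtr1 ltr_sqrt.
have qI : Num.sqrt y \in `[-1, 1] by rewrite in_itv/=; lra.
split; last by rewrite asinK// sqr_sqrtr// ltW.
apply/andP; split; last by apply: asin_ltpi2; rewrite q1 andbT; lra.
have p0 := pi_gt0 R.
rewrite ltNge; apply/negP => a0.
have : sin (asin (Num.sqrt y)) <= 0.
  rewrite -oppr_ge0 -sinN; apply: sin_ge0_pi; rewrite oppr_ge0 a0 /=.
  have := @asin_geNpi2 _ (Num.sqrt y); lra.
by rewrite asinK// leNgt q0.
Qed.

(** The multiplicity depends on [sin k ^+ 2] only, hence is invariant under [k -> pi - k]: the
    quarter list is reflected, and [pi / 2] and [pi] are added with their own multiplicities. The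
    total is the length of the graph. *)
Lemma period_block : exists s : seq R,
  [/\ sorted <=%R s, all (fun t : R => 0 < t <= pi) s,
      size s = (2 * ND + NN + 5 * NB)%N,
      count (fun t => t < pi / 2) s = (NB + (0 < ND))%N &
      forall t : R, 0 < t <= pi -> count_mem t s = ymult (sin t ^+ 2)].
Proof.
have [Y [Y01 Ysize Ycount]] := quarter_values.
have p0 := pi_gt0 R.
pose Q := [seq asin (Num.sqrt y) | y <- Y].
have Q01 t : t \in Q -> 0 < t < pi / 2.
  by move=> /mapP[y /(allP Y01) y01 ->]; case: (asin_sqrt_bij y01).
have Qcount t : 0 < t < pi / 2 -> count_mem t Q = ymult (sin t ^+ 2).
  move=> t01; have [y01 yt] := sin_sqr_bij t01.
  rewrite -Ycount// count_map; apply: eq_in_count => y /(allP Y01) y01' /=.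
  apply/eqP/eqP => [<-|->//]; by rewrite (asin_sqrt_bij y01').2.
have Qout t : ~~ (0 < t < pi / 2) -> count_mem t Q = 0%N.
  by move=> tout; apply/count_memPn; apply: contra tout => /Q01.
pose m := (ND + NN + NB + NB).-1.
pose m' := ((if ND == 0%N then 1 else ND.-1) + NB)%N.
pose s0 := Q ++ nseq m (pi / 2) ++ [seq pi - t | t <- Q] ++ nseq m' pi.
have s0P t : t \in s0 -> 0 < t <= pi.
  rewrite !mem_cat.
  by move=> /or4P[/Q01|/nseqP[-> _]|/mapP[u /Q01 ? ->]|/nseqP[-> _]]; lra.
exists (sort <=%R s0); split.
- exact/sort_sorted/le_total.
- by apply/allP => t; rewrite mem_sort; exact: s0P.
- rewrite size_sort !size_cat !size_nseq !size_map Ysize /m /m' lt0n.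
  by move: legs_gt1; case: eqP => /=; lia.
- have /permP -> : perm_eq (sort <=%R s0) s0 by rewrite perm_sort.
  have cQ : count (fun t => t < pi / 2) Q = size Q.
    by apply/eqP; rewrite -all_count; apply/allP => t /Q01 /andP[].
  have cQ' : count (fun t => t < pi / 2) [seq pi - t | t <- Q] = 0%N.
    apply/eqP; rewrite -leqn0 leqNgt -has_count; apply/hasPn => t.
    by move=> /mapP[u /Q01 ? ->]; rewrite /= -leNgt; lra.
  rewrite !count_cat !count_nseq cQ cQ' /= ltxx [pi < _]le_gtF; last lra.
  by rewrite !mul0n !addn0 size_map Ysize.
move=> t t01; have /permP -> : perm_eq (sort <=%R s0) s0 by rewrite perm_sort.
have cM : count_mem t [seq pi - u | u <- Q] = count_mem (pi - t) Q.
  by rewrite count_map; apply: eq_count => u /=; apply/eqP/eqP => ?; lra.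
rewrite !count_cat !count_nseq cM.
case: (ltgtP t (pi / 2)) => tpi.
- rewrite Qcount; last by lra.
  rewrite (Qout (pi - t)); last by lra.
  by rewrite /= [pi / 2 == t]gt_eqF// [pi == t]gt_eqF ?mul0n ?addn0//; lra.
- rewrite (Qout t); last by lra.
  rewrite /= [pi / 2 == t]lt_eqF// mul0n !add0n.
  have [tE|tn] := eqVneq pi t.
    rewrite -tE subrr Qout ?ltxx// sinpi expr0n /ymult eqxx /= /m'.
    by rewrite mul1n.
  have tltpi : t < pi by rewrite lt_neqAle eq_sym tn; case/andP: t01.
  rewrite Qcount; last by lra.
  by rewrite mul0n addn0 sinB sinpi cospi mul0r mulN1r sub0r opprK.
- rewrite tpi (Qout (pi / 2)); last by lra.
  rewrite (Qout (pi - pi / 2)); last by lra.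
  rewrite /= eqxx [pi == _]gt_eqF; last by lra.
  rewrite sin_pihalf expr1n /ymult oner_eq0 eqxx /m.
  by rewrite mul1n mul0n !addn0.
Qed.

End Block.

(** * Unrolling a sorted list periodically *)

Section PeriodicListing.
Variables (R : realType) (p : R) (s : seq R).
Hypotheses (p_gt0 : 0 < p) (s_sorted : sorted <=%R s) (s_neq0 : (0 < size s)%N).
Hypothesis s_period : all (fun t : R => 0 < t <= p) s.

Definition periodic_seq (n : nat) : R :=
  nth 0 s (n %% size s) + p * (n %/ size s)%:R.

Let nthP n : 0 < nth 0 s (n %% size s) <= p.
Proof. by apply: (allP s_period); rewrite mem_nth// ltn_mod. Qed.

Lemma periodic_seq_gt0 n : 0 < periodic_seq n.
Proof.
have /andP[t0 _] := nthP n.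
by rewrite ltr_wpDr// mulr_ge0// ltW.
Qed.

Lemma periodic_seq_nondecreasing n : periodic_seq n <= periodic_seq n.+1.
Proof.
have /andP[t0 tp] := nthP n; have /andP[u0 up] := nthP n.+1.
rewrite /periodic_seq; have [lt_n|ge_n] := ltnP (n %% size s).+1 (size s).
  have nE : n.+1 = (n %/ size s * size s + (n %% size s).+1)%N.
    by rewrite addnS -divn_eq.
  have -> : (n.+1 %% size s)%N = (n %% size s).+1.
    by rewrite nE modnMDl modn_small.
  have -> : (n.+1 %/ size s)%N = (n %/ size s)%N.
    by rewrite nE divnMDl// (divn_small lt_n) addn0.
  rewrite lerD2r.
  by apply: sorted_leq_nth; rewrite ?inE ?ltn_mod//; exact: le_trans.
have nE : n.+1 = ((n %/ size s).+1 * size s)%N.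
  rewrite mulSn addnC {1}(divn_eq n (size s)) -addnS; congr addn.
  by apply/eqP; rewrite eqn_leq ge_n ltn_mod s_neq0.
rewrite (_ : (n.+1 %/ size s)%N = (n %/ size s).+1); last by rewrite nE mulnK.
by rewrite -[(n %/ size s).+1%:R]natr1 mulrDr mulr1; lra.
Qed.

Lemma periodic_seq_eq (t : R) j n : 0 < t <= p ->
  (periodic_seq n == t + p * j%:R) =
  (j * size s + count (fun u => u < t)%R s <= n <
   j * size s + count (fun u => u < t)%R s + count_mem t s)%N.
Proof.
move=> /andP[t0 tp]; have /andP[u0 up] := nthP n; rewrite /periodic_seq.
set a := count _ s; set c := count_mem t s.
have acE : (a + c = count (fun u => u <= t)%R s)%N.
  rewrite -count_predUI [count (predI _ _) s](_ : _ = 0%N) ?addn0.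
    by apply: eq_count => u /=; rewrite orbC -le_eqVlt.
  by rewrite -(count_pred0 s); apply: eq_count => u /=; case: ltgtP.
have a_le : (a + c <= size s)%N by rewrite acE count_size.
have nthE i : (i < size s)%N -> (nth 0 s i == t) = (a <= i < a + c)%N.
  move=> i_lt; apply/eqP/idP => [it|/andP[ai iac]]; last first.
    by apply: nth_count_eq => //; rewrite -[X in (X <= _)%N]/a ai -acE.
  apply/andP; split; [rewrite leqNgt|rewrite ltnNge]; apply/negP => H.
    by have := nth_count_lt 0 s_sorted H; rewrite it ltxx.
  rewrite acE in H; have := @nth_count_gt _ _ t 0 s i s_sorted.
  by rewrite H i_lt it ltxx => /(_ isT).
have rlt : (n %% size s < size s)%N by rewrite ltn_mod.
have [qj|qj] := eqVneq (n %/ size s)%N j.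
  rewrite qj (inj_eq (addIr _)) nthE//.
  have nE : n = (j * size s + n %% size s)%N by rewrite -qj -divn_eq.
  by rewrite [in RHS]nE -addnA leq_add2l ltn_add2l.
have nE := divn_eq n (size s).
have -> : (nth 0 s (n %% size s) + p * (n %/ size s)%:R == t + p * j%:R)
    = false.
  apply/negbTE/eqP => H; move: qj; rewrite neq_ltn => /orP[] lt_q.
    have : (n %/ size s).+1%:R <= j%:R :> R by rewrite ler_nat.
    by rewrite -natr1 -(ler_pM2l p_gt0) mulrDr mulr1; lra.
  have : j.+1%:R <= (n %/ size s)%:R :> R by rewrite ler_nat.
  by rewrite -natr1 -(ler_pM2l p_gt0) mulrDr mulr1; lra.
apply/esym/negbTE/negP => /andP[]; rewrite {1 2}nE => le_n lt_n.
move: qj; rewrite neq_ltn => /orP[] lt_q.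
  have := leq_mul lt_q (leqnn (size s)); rewrite mulSn; lia.
have := leq_mul lt_q (leqnn (size s)); rewrite mulSn; lia.
Qed.

Lemma period_decomposition (k : R) : 0 < k ->
  exists t j, 0 < t <= p /\ k = t + p * j%:R.
Proof.
move=> k0; have ex : exists j, k <= p * j.+1%:R.
  exists (Num.truncn (k / p)); rewrite mulrC -ler_pdivrMr//.
  by rewrite ltW// truncnS_gt.
have [j kj jmin] := ex_minnP ex.
exists (k - p * j%:R), j; split; last by rewrite subrK.
rewrite subr_gt0 lerBlDr -[X in _ <= X + _]mulr1 -mulrDr addrC natr1 kj andbT.
case: j jmin {kj} => [|j] jmin; first by rewrite mulr0.
by rewrite ltNge; apply/negP => /jmin; rewrite ltnn.
Qed.

End PeriodicListing.

Lemma card_nat_interval (A : set nat) (a m : nat) :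
  (forall n, A n <-> (a <= n < a + m)%N) -> (A #= `I_m)%card.
Proof.
move=> AP; have -> : A = [set (a + i)%N | i in `I_m]%classic.
  apply/seteqP; split=> n.
    move=> /AP/andP[an nm].
    by exists (n - a)%N => /=; rewrite ?subnKC ?ltn_subLR.
  by move=> [i /= im <-]; apply/AP; rewrite leq_addr ltn_add2l.
by apply: inj_card_eq => i j _ _; exact: addnI.
Qed.

Lemma sin_sqr_periodic (R : realType) (t : R) j :
  sin (t + pi * j%:R) ^+ 2 = sin t ^+ 2.
Proof.
elim: j => [|j IH]; first by rewrite mulr0 addr0.
by rewrite -natr1 mulrDr mulr1 addrA sinDpi sqrrN.
Qed.

(** * The spectrum of the star and its sharp eigenvalues *)

Section Listing.
Variables (R : realType) (ND NN NB : nat).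
Hypothesis legs_gt1 : (1 < ND + NN + NB)%N.
Local Notation D := (dirichlet_ends R ND NN NB).
Variable s : seq R.
Hypothesis s_sorted : sorted <=%R s.
Hypothesis s_period : all (fun t : R => 0 < t <= pi) s.
Hypothesis s_size : size s = (2 * ND + NN + 5 * NB)%N.
Hypothesis s_quarter : count (fun t => t < pi / 2) s = (NB + (0 < ND))%N.
Hypothesis s_mult :
  forall t : R, 0 < t <= pi -> count_mem t s = ymult ND NN NB (sin t ^+ 2).

Let s_neq0 : (0 < size s)%N.
Proof. by rewrite s_size; move: legs_gt1; lia. Qed.

(* The [z] first terms are the eigenvalue 0. *)
Let z : nat := ND == 0%N.

(** Eigenvalues are numbered from 1 and [periodic_seq] from 0, whence the predecessor. *)
Definition star_spectrum (n : nat) : R :=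
  if (n <= z)%N then 0 else periodic_seq pi s (n - z).-1 ^+ 2.

Lemma star_spectrum_eq (t : R) j n : 0 < t <= pi ->
  star_spectrum n = (t + pi * j%:R) ^+ 2 <->
  (z.+1 + j * size s + count (fun u => u < t)%R s <= n <
   z.+1 + j * size s + count (fun u => u < t)%R s + count_mem t s)%N.
Proof.
move=> t01; have pi0 := pi_gt0 R.
have k0 : 0 < t + pi * j%:R.
  by case/andP: t01 => t0 _; rewrite ltr_wpDr// mulr_ge0// ltW.
rewrite /star_spectrum; have [nz|nz] := leqP n z.
  split=> [/esym/eqP|]; first by rewrite sqrf_eq0 gt_eqF.
  by lia.
have E := periodic_seq_eq pi0 s_sorted s_neq0 s_period j (n - z).-1 t01.
have g0 := periodic_seq_gt0 pi0 s_neq0 s_period (n - z).-1.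
transitivity (periodic_seq pi s (n - z).-1 = t + pi * j%:R).
  split=> [/eqP|->//]; rewrite eqrXn2 ?ltW// => /eqP; exact.
split=> [/eqP|H]; first by rewrite E; lia.
by apply/eqP; rewrite E; lia.
Qed.

Lemma star_spectrum_listing : eigenvalue_listing D star_spectrum.
Proof.
have pi0 := pi_gt0 R; split.
  move=> n _; rewrite /star_spectrum; have [nz|nz] := leqP n z.
    by case: ifP => // _; exact: sqr_ge0.
  rewrite leqNgt ltnW//= subSn ?(ltnW nz)//.
  rewrite -(ltn_predK (_ : 0 < n - z)%N) ?subn_gt0//= lerXn2r ?nnegrE//.
  - by rewrite ltW// periodic_seq_gt0.
  - by rewrite ltW// periodic_seq_gt0.
  - exact: periodic_seq_nondecreasing.
move=> x; case: (ltgtP x 0) => x0.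
- exists 0%N; split; first exact: multiplicity_neg.
  apply: (@card_nat_interval _ 0) => n; split=> // -[_ nx].
  have : 0 <= star_spectrum n.
    by rewrite /star_spectrum; case: ifP => // _; exact: sqr_ge0.
  by rewrite nx leNgt x0.
- have k0 : 0 < Num.sqrt x by rewrite sqrtr_gt0.
  have [t [j [t01 kE]]] := period_decomposition pi0 k0.
  have xE : x = (t + pi * j%:R) ^+ 2 by rewrite -kE sqr_sqrtr// ltW.
  exists (count_mem t s); split.
    rewrite s_mult// -(sin_sqr_periodic t j) xE; apply: multiplicity_pos => //.
    by rewrite -kE.
  apply: (@card_nat_interval _
    (z.+1 + j * size s + count (fun u => u < t) s)) => n.
  rewrite -(star_spectrum_eq j n t01) -xE.
  (* The index 0 has to be excluded: there the listing takes the value 0, not [x > 0]. *)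
  split=> [[]//|nx]; split=> //; case: n nx => // nx.
  by move: x0; rewrite -nx /star_spectrum leq0n ltxx.
- exists z; split; first by rewrite x0; exact: multiplicity0.
  apply: (@card_nat_interval _ 1) => n; rewrite x0 add1n ltnS /= /star_spectrum.
  have [nz|nz] := leqP n z; first by rewrite andbT; split=> [[]|].
  rewrite andbF; split=> // -[_ /eqP]; rewrite sqrf_eq0 gt_eqF//.
  exact: periodic_seq_gt0.
Qed.

(** The indices run from [j L + NB + 2] to [j L + ND + NN + 3 NB], where [L] is the length. The
    brackets of the upper bound at the first and of the lower bound at the last are both
    [j L + L / 2]. *)
Lemma star_spectrum_sharp j :
  sharp D star_spectrum ((pi / 2 + pi * j%:R) ^+ 2).
Proof.
have pi0 := pi_gt0 R.
have t01 : 0 < (pi / 2 : R) <= pi by lra.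
have deg_center : (1 < #|leg ND NN NB|)%N by rewrite card_leg.
have cE : count_mem (pi / 2) s = (ND + NN + NB + NB).-1.
  by rewrite s_mult// sin_pihalf expr1n /ymult oner_eq0 eqxx.
(* Either 0 is an eigenvalue or Dirichlet legs add one eigenvalue to the first quarter, so [NB + 1]
   eigenvalues precede [(pi / 2) ^+ 2] in both cases. *)
have zE : (z + (0 < ND))%N = 1%N by rewrite /z lt0n; case: (ND == 0%N).
have nE : (z.+1 + j * size s + (NB + (0 < ND)) = j * size s + NB + 2)%N.
  by move: zE; lia.
have eqP n : star_spectrum n = (pi / 2 + pi * j%:R) ^+ 2 <->
    (j * size s + NB + 2 <= n < j * size s + NB + 2 + (ND + NN + NB + NB).-1)%N.
  by rewrite (star_spectrum_eq j n t01) s_quarter cE nE.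
have L0 : (2 * ND + NN + 5 * NB)%N%:R != 0 :> R.
  by rewrite pnatr_eq0 -s_size -lt0n.
have LE : (2 * ND + NN + 5 * NB)%N%:R = 2 * ND%:R + NN%:R + 5 * NB%:R :> R.
  by rewrite natrD natrD !natrM.
have m0 : (0 < (ND + NN + NB + NB).-1)%N by move: legs_gt1; lia.
have lE : (j * size s + NB + 2 + (ND + NN + NB + NB).-1 - 1 =
    j * size s + ND + NN + 3 * NB)%N by move: legs_gt1; lia.
exists (j * size s + NB + 2)%N, (ND + NN + NB + NB).-1; split.
- by split=> //; rewrite addn2.
- by move=> i _; exact: eqP.
- rewrite /upper_sharp ((eqP _).2 _); last first.
    by rewrite leqnn -[X in (X < _)%N]addn0 ltn_add2l.
  rewrite /upper_bound lstar_length card_dirichlet_ends// card_neumann//.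
  rewrite lstar_betti// s_size !(natrD, natrM) -pmulrn.
  by field; rewrite -LE.
- rewrite /lower_sharp ((eqP _).2 _); last first.
    by rewrite -addnBA// leq_addr ltn_add2l; lia.
  rewrite lE /lower_bound lstar_length card_dirichlet_ends// card_neumann//.
  rewrite lstar_betti// -pmulrn -natrD ltr_nat.
  rewrite ifF; last by move: legs_gt1; lia.
  rewrite ifF; last by lia.
  rewrite s_size !(natrD, natrM).
  by field; rewrite -LE.
Qed.

End Listing.

Theorem theorem3p4 (R : realType) (N0 D0 beta0 : nat)
    (h : (2 <= N0 + D0 + beta0)%N) :
  exists (G : metric_graph R) (D : {set {set endpoint G}}),
    [/\ connected_graph G,
        D \subset pendants G,
        #|D| = D0,
        #|(pendants G :\: D)%SET| = N0
      & betti G = beta0%:Z] /\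
    exists lambda : nat -> R,
      eigenvalue_listing D lambda /\
      exists x : nat -> R,
        injective x /\ forall k, sharp D lambda (x k).
Proof.
have legs_gt1 : (1 < D0 + N0 + beta0)%N by rewrite [(D0 + N0)%N]addnC.
have deg_center : (1 < #|leg D0 N0 beta0|)%N by rewrite card_leg.
exists (lstar R D0 N0 beta0), (dirichlet_ends R D0 N0 beta0); split.
  split; [exact: lstar_connected|exact: dirichlet_ends_sub|
    exact: card_dirichlet_ends|exact: card_neumann|exact: lstar_betti].
have [s [ss sp sz sq sm]] := period_block R legs_gt1.
exists (star_spectrum D0 s); split; first exact: star_spectrum_listing.
exists (fun j => (pi / 2 + pi * j%:R) ^+ 2); split; last first.
  by move=> j; exact: star_spectrum_sharp.
have pi0 := pi_gt0 R.
have k0 j : 0 <= pi / 2 + pi * j%:R :> R.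
  by rewrite addr_ge0 ?mulr_ge0 ?divr_ge0 ?(ltW pi0).
move=> i j /eqP; rewrite eqrXn2//.
by rewrite (inj_eq (addrI _)) (inj_eq (mulfI (lt0r_neq0 pi0))) eqr_nat => /eqP.
Qed.
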